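(* Let $1<p<\infty$, $\alpha\ge p-1$, $\mu\ge0$, and let $\Omega\subset\mathbb{R}^N$ ($N\ge1$) be a smooth bounded domain. Let $h:\mathbb{R}\to\mathbb{R}$ be a (strictly) increasing continuous function and let $a,b\in L^\infty_{loc}(\Omega)$, where for every smooth open set $O\subset\subset\Omega$ there exists $a_O>0$ such that $a(x)\ge a_O$ for almost every $x\in O$. Suppose $u,v\in W^{1,\infty}_{loc}(\Omega)\cap C(\Omega)$ satisfy $$\int_\Omega|\nabla u|^{p-2}\nabla u\cdot\nabla\varphi\,dx+\int_\Omega\big[a(x)h(u)+\mu b(x)|\nabla u|^\alpha\big]\varphi\,dx\le0$$ and $$\int_\Omega|\nabla v|^{p-2}\nabla v\cdot\nabla\varphi\,dx+\int_\Omega\big[a(x)h(v)+\mu b(x)|\nabla v|^\alpha\big]\varphi\,dx\ge0$$ for all $\varphi\in C_0^\infty(\Omega)$ with $\varphi\ge0$, and that $$\lim_{x\to y}\big(u(x)-v(x)\big)\in[-\infty,0]\quad\text{for each }y\in\partial\Omega.$$ Then $u\le v$ in $\Omega$.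
   Context: $O\subset\subset\Omega$ means that $\overline{O}$ is a compact subset of $\Omega$. The function $b$ may change sign. *)

(* Defs.v *)
From HB Require Import structures.
From mathcomp Require Import all_boot all_order all_algebra.
From mathcomp Require Import all_classical all_reals all_analysis.
Import Order.TTheory GRing.Theory Num.Theory.
Import numFieldNormedType.Exports.

Set Implicit Arguments.
Unset Strict Implicit.
Unset Printing Implicit Defensive.

Local Open Scope classical_set_scope.
Local Open Scope ring_scope.

(* R^n is 'rV[R]_n, with the library's topology (its norm is the sup norm,
   which is equivalent to the Euclidean one) and the sigma-algebra generated
   by the coordinates, i.e. the Borel sigma-algebra. *)
Section measurable_row.
Context {R : realType} (n : nat).

Let coord (i : 'I_n) (x : 'rV[R]_n) : R := x ord0 i.

Let row_set0 : g_sigma_preimage coord set0.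
Proof. exact: sigma_algebra0. Qed.

Let row_setC A : g_sigma_preimage coord A -> g_sigma_preimage coord (~` A).
Proof. exact: sigma_algebraC. Qed.

Let row_bigcup (F : (set _)^nat) : (forall i, g_sigma_preimage coord (F i)) ->
  g_sigma_preimage coord (\bigcup_i (F i)).
Proof. exact: sigma_algebra_bigcup. Qed.

HB.instance Definition _ := @isMeasurable.Build default_measure_display
  'rV[R]_n (g_sigma_preimage coord) row_set0 row_setC row_bigcup.

Lemma measurable_coord (i : 'I_n) :
  measurable_fun [set: 'rV[R]_n] (fun x => x ord0 i).
Proof.
move=> _ Y mY; rewrite setTI; apply: sub_sigma_algebra => /=.
rewrite -bigcup_seq/=; exists i => /=; first by rewrite mem_index_enum.
by exists Y => //; rewrite setTI.
Qed.

Lemma measurable_fun_coord d (T : measurableType d) (f : T -> 'rV[R]_n) :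
  (forall i, measurable_fun [set: T] (fun t => f t ord0 i)) ->
  measurable_fun [set: T] f.
Proof.
move=> mf.
suff : g_sigma_preimage (fun i => coord i \o f) `<=` measurable.
  by rewrite g_sigma_preimage_comp => prefS _ A mA; apply: prefS; exists A.
apply: smallest_sub; first exact: sigma_algebra_measurable.
by rewrite -bigcup_seq; apply: bigcup_sub => i _ A [B mB <-]; exact: mf.
Qed.

End measurable_row.

Section lebesgue_row.
Context {R : realType}.

Definition cons_row n (z : measurableTypeR R * 'rV[R]_n) : 'rV[R]_n.+1 :=
  \row_j (if unlift ord0 j is Some k then z.2 ord0 k else z.1).

Definition uncons_row n (x : 'rV[R]_n.+1) :
    measurableTypeR R * 'rV[R]_n :=
  (x ord0 ord0, \row_k x ord0 (lift ord0 k)).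

Lemma cons_rowK n : cancel (@cons_row n) (@uncons_row n).
Proof.
move=> [x v]; rewrite /uncons_row mxE unlift_none; congr pair.
by apply/rowP => k; rewrite !mxE liftK.
Qed.

Lemma uncons_rowK n : cancel (@uncons_row n) (@cons_row n).
Proof.
by move=> x; apply/rowP => j; rewrite !mxE; case: unliftP => [k|] ->; rewrite ?mxE.
Qed.

Lemma measurable_cons_row n :
  measurable_fun [set: measurableTypeR R * 'rV[R]_n] (@cons_row n).
Proof.
apply: measurable_fun_coord => j; case: (unliftP ord0 j) => [k|] ->.
  rewrite (_ : (fun _ => _) = (fun x : 'rV[R]_n => x ord0 k) \o snd).
    exact: measurableT_comp (measurable_coord k) measurable_snd.
  by apply/funext => z; rewrite mxE liftK.
rewrite (_ : (fun _ => _) = fst); first exact: measurable_fst.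
by apply/funext => z; rewrite mxE unlift_none.
Qed.

Lemma measurable_uncons_row n :
  measurable_fun [set: 'rV[R]_n.+1] (@uncons_row n).
Proof.
apply/measurable_fun_pairP; split; first exact: measurable_coord.
apply: measurable_fun_coord => k.
rewrite (_ : (fun _ => _) = (fun x : 'rV[R]_n.+1 => x ord0 (lift ord0 k))).
  exact: measurable_coord.
by apply/funext => x; rewrite mxE.
Qed.

Definition lebesgue_step n (mu : {sigma_finite_measure set 'rV[R]_n -> \bar R})
    : set 'rV[R]_n.+1 -> \bar R :=
  pushforward (@lebesgue_measure R \x mu)%E (@cons_row n).

Section step.
Context n (mu : {sigma_finite_measure set 'rV[R]_n -> \bar R}).

Let step0 : lebesgue_step mu set0 = 0%E.
Proof. by rewrite /lebesgue_step /pushforward preimage_set0 measure0. Qed.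

Let step_ge0 A : (0 <= lebesgue_step mu A)%E.
Proof. by rewrite /lebesgue_step /pushforward. Qed.

Let step_sigma_additive : semi_sigma_additive (lebesgue_step mu).
Proof.
move=> F mF tF mUF; rewrite /lebesgue_step /pushforward preimage_bigcup.
have mG A : measurable A -> measurable (@cons_row n @^-1` A).
  by move=> mA; rewrite -[X in measurable X]setTI; exact: measurable_cons_row.
apply: measure_semi_sigma_additive => [k| |]; first exact: mG.
- apply/trivIsetP => /= i j _ _ ij; rewrite -preimage_setI.
  by move/trivIsetP : tF => /(_ _ _ _ _ ij) ->//; rewrite preimage_set0.
- by rewrite -preimage_bigcup; exact: mG.
Qed.

HB.instance Definition _ := isMeasure.Build _ _ _ (lebesgue_step mu)
  step0 step_ge0 step_sigma_additive.

Lemma sigma_finite_lebesgue_step : sigma_finite setT (lebesgue_step mu).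
Proof.
have /sigma_finiteP[F [TF ndF Foo]] := sigma_finiteT (@lebesgue_measure R).
have /sigma_finiteP[G [TG ndG Goo]] := sigma_finiteT mu.
exists (fun k => @uncons_row n @^-1` (F k `*` G k)).
  rewrite -preimage_bigcup -(@preimage_setT _ _ (@uncons_row n)).
  congr (_ @^-1` _); rewrite -setXTT TF TG predeqE => -[x y]; split.
    move=> [/= [i _ Fx] [k _ Gy]]; exists (maxn i k) => //; split.
    - by move: x Fx; exact/subsetPset/ndF/leq_maxl.
    - by move: y Gy; exact/subsetPset/ndG/leq_maxr.
  by move=> [k _ []/= ? ?]; split; exists k.
move=> k; have [mF Fk] := Foo k; have [mG Gk] := Goo k; split.
  rewrite -[X in measurable X]setTI; apply: measurable_uncons_row => //.
  exact: measurableX.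
rewrite /lebesgue_step /pushforward -comp_preimage.
rewrite (_ : _ \o _ = id) ?preimage_id.
  by rewrite product_measure1E// lte_mul_pinfty// ge0_fin_numE.
by apply/funext => z; exact: cons_rowK.
Qed.

HB.instance Definition _ := Measure_isSigmaFinite.Build _ _ _ (lebesgue_step mu)
  sigma_finite_lebesgue_step.
End step.

(* N-dimensional Lebesgue measure, as an iterated product measure *)
Fixpoint lebesgueN (n : nat) : {sigma_finite_measure set 'rV[R]_n -> \bar R} :=
  match n with
  | 0 => dirac (0 : 'rV[R]_0)
  | n'.+1 => lebesgue_step (lebesgueN n')
  end.

End lebesgue_row.

Section calculus.
Context {R : realType} {N : nat}.
Implicit Types (U O : set 'rV[R]_N) (f g : 'rV[R]_N -> R).

Definition dotv (x y : 'rV[R]_N) : R := \sum_(i < N) x ord0 i * y ord0 i.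

(* Euclidean norm; `|x| is the sup norm *)
Definition enorm (x : 'rV[R]_N) : R := Num.sqrt (dotv x x).

Definition partial (i : 'I_N) f : 'rV[R]_N -> R :=
  fun x => 'D_(delta_mx ord0 i) f x.

Definition grad f (x : 'rV[R]_N) : 'rV[R]_N := \row_i partial i f x.

Fixpoint Cn (k : nat) f : Prop :=
  continuous f /\
  match k with
  | 0 => True
  | k'.+1 => forall i : 'I_N,
      (forall x, derivable f x (delta_mx ord0 i)) /\ Cn k' (partial i f)
  end.

Definition Cinfty f : Prop := forall k, Cn k f.

Definition compactly_contained O U : Prop :=
  compact (closure O) /\ closure O `<=` U.

(* C_0^infty(U) *)
Definition test_function U f : Prop :=
  Cinfty f /\ compactly_contained [set x | f x != 0] U.

Definition bdry U : set 'rV[R]_N := closure U `\` U°.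

(* Open set with C^infty boundary: near each boundary point, U is the sublevel
   set of a smooth function with nonvanishing gradient. *)
Definition smooth_open U : Prop :=
  open U /\
  forall y, bdry U y -> exists (V : set 'rV[R]_N) (rho : 'rV[R]_N -> R),
    [/\ nbhs y V, Cinfty rho, grad rho y != 0 &
        U `&` V = [set x | rho x < 0] `&` V].

(* L^infty_loc(U), through Borel representatives *)
Definition Linfty_loc U f : Prop :=
  measurable_fun U f /\
  forall O, open O -> compactly_contained O U ->
    exists M : R, {ae lebesgueN N, forall x, O x -> `|f x| <= M}.

(* G is the weak gradient of f in U *)
Definition weak_gradient U f (G : 'rV[R]_N -> 'rV[R]_N) : Prop :=
  forall (i : 'I_N) (phi : 'rV[R]_N -> R), test_function U phi ->
    \int[lebesgueN N]_(x in U) (f x * partial i phi x) =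
    - (\int[lebesgueN N]_(x in U) (G x ord0 i * phi x)).

(* f belongs to W^{1,infty}_loc(U), with weak gradient (represented by) G *)
Definition W1infty_loc U f (G : 'rV[R]_N -> 'rV[R]_N) : Prop :=
  [/\ Linfty_loc U f, forall i : 'I_N, Linfty_loc U (fun x => G x ord0 i)
    & weak_gradient U f G].

(* |G|^{p-2} G; it vanishes at G = 0 for every p, as powR is finite at 0 *)
Definition pflux (p : R) (G : 'rV[R]_N) : 'rV[R]_N := (enorm G `^ (p - 2)) *: G.

Definition weak_form U (p alpha mu : R) (h : R -> R) (a b : 'rV[R]_N -> R)
    (w : 'rV[R]_N -> R) (Dw : 'rV[R]_N -> 'rV[R]_N) (phi : 'rV[R]_N -> R) : R :=
  (\int[lebesgueN N]_(x in U) dotv (pflux p (Dw x)) (grad phi x)) +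
  (\int[lebesgueN N]_(x in U)
    ((a x * h (w x) + mu * b x * enorm (Dw x) `^ alpha) * phi x)).

End calculus.

(* Main.v *)
(* Suppose u - v is positive somewhere, and let m > 0 be the maximum of the
   truncation g = (u - v - k)^+, which is continuous with compact support in
   Omega for small k > 0.  Test both inequalities with phi = Psi(g * rho_r),
   where rho_r is a smooth mollifier and Psi(s) = exp(-1/(s - kap)) for s > kap,
   Psi = 0 for s <= kap, with kap < m close to m.  Where g * rho_r > kap, the
   gradient of g * rho_r is the mollification of Du - Dv, so it converges to
   Du - Dv in L^1 as r tends to 0; no chain rule for Sobolev functions is needed.
   On bounded sets of gradients, for every d > 0,
     mu |b| ||xi|^alpha - |eta|^alpha|
       <= d + C (|xi|^(p-2) xi - |eta|^(p-2) eta).(xi - eta),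
   because the left-hand side vanishes whenever the flux term does.  As
   Psi' >= C Psi on ]kap, m] when m - kap is small, the flux term absorbs the
   gradient term, and what is left of a (h(u) - h(v)) makes the difference of the
   two weak forms at least d times the integral of phi up to a vanishing error:
   this contradicts its being nonpositive. *)
Require Import Defs.
From mathcomp Require Import all_boot all_order all_algebra.
From mathcomp Require Import all_classical all_reals all_analysis.
From mathcomp Require Import measurable_realfun ring lra.
Import Order.TTheory GRing.Theory Num.Theory.
Import numFieldNormedType.Exports.

Set Implicit Arguments.
Unset Strict Implicit.
Unset Printing Implicit Defensive.

Local Open Scope classical_set_scope.
Local Open Scope ring_scope.

(** * Smooth functions of one variable *)

Section smooth1.
Context {R : realType}.
Implicit Types f g : R -> R.

(** Two obstacles shape the argument: test functions must be C^infty, while g is merely continuous;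
    and b may change sign, so the gradient term cannot be dropped. The exponential answers both. All
    its derivatives vanish at 0+, so Psi(g * rho_r) is smooth although Psi cuts off at kap; and
    Psi'/Psi = (s - kap)^(-2) exceeds any prescribed C close to kap. The second point matters
    because C comes from a compactness argument and is not explicit. The constants are chosen in
    this order. The level k fixes V = {u - v > k}, which is relatively compact in Omega, hence
    bounds for all data on V; d is half of a lower bound of a (h(u) - h(v)) on V; C depends on d and
    on the gradient bound; m - kap depends on C; only then is r chosen. The last choice is harmless
    because the integral of phi has a lower bound valid for all small r: around a maximum point of g
    there is a fixed ball on which g * rho_r stays above kap by a fixed margin. A smooth function
    supported in V is obtained with no regularity of V: if g * rho_r exceeds kap at x, the whole
    ball of radius r around x lies in V, and there g is exactly u - v - k. *)

Fixpoint smoothn (k : nat) f : Prop :=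
  continuous f /\
  match k with
  | 0 => True
  | k'.+1 => (forall x, derivable f x 1) /\ smoothn k' (derive1 f)
  end.

Definition smooth f := forall k, smoothn k f.

Lemma smoothnW k f : smoothn k.+1 f -> smoothn k f.
Proof.
elim: k f => [|k IH] f [cf [df sf]]; first by split.
by split => //; split => //; exact: IH.
Qed.

Lemma smooth_continuous f : smooth f -> continuous f.
Proof. by move=> /(_ 0) []. Qed.

Lemma smooth_derivable f : smooth f -> forall x, derivable f x 1.
Proof. by move=> /(_ 1) [_ []]. Qed.

Lemma smooth_derive1 f : smooth f -> smooth (derive1 f).
Proof. by move=> sf k; have [_ []] := sf k.+1. Qed.

Lemma derivable_continuous f : (forall x, derivable f x 1) -> continuous f.
Proof. by move=> df x; apply: differentiable_continuous; exact/derivable1_diffP. Qed.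

Lemma smoothn_cst k (c : R) : smoothn k (fun _ => c).
Proof.
elim: k c => [|k IH] c; first by split => // x; exact: cvg_cst.
split; first by move=> x; exact: cvg_cst.
split; first by move=> x; exact: derivable_cst.
rewrite (_ : derive1 _ = fun _ => 0) //; apply/funext => x.
exact: derive1_cst.
Qed.

Lemma smoothnD k f g : smoothn k f -> smoothn k g -> smoothn k (fun x => f x + g x).
Proof.
elim: k f g => [|k IH] f g [cf sf] [cg sg].
  by split => // x; apply: cvgD; [exact: cf|exact: cg].
have [df sf'] := sf; have [dg sg'] := sg.
split; first by move=> x; apply: cvgD; [exact: cf|exact: cg].
split; first by move=> x; exact: derivableD.
rewrite (_ : derive1 _ = fun x => derive1 f x + derive1 g x); first exact: IH.
by apply/funext => x; rewrite !derive1E deriveD.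
Qed.

Lemma smoothnM k f g : smoothn k f -> smoothn k g -> smoothn k (fun x => f x * g x).
Proof.
elim: k f g => [|k IH] f g sf sg.
  case: sf => cf _; case: sg => cg _.
  by split => // x; apply: cvgM; [exact: cf|exact: cg].
have sf0 := smoothnW sf; have sg0 := smoothnW sg.
case: sf => cf [df sf]; case: sg => cg [dg sg].
split; first by move=> x; apply: cvgM; [exact: cf|exact: cg].
split; first by move=> x; exact: derivableM.
rewrite (_ : derive1 _ = fun x => f x * derive1 g x + g x * derive1 f x).
  by apply: smoothnD; exact: IH.
by apply/funext => x; rewrite !derive1E deriveM.
Qed.

Lemma is_derive_affine f (a s x d : R) : is_derive (a + s * x) 1 f d ->
  is_derive x 1 (fun t => f (a + s * t)) (s * d).
Proof.
move=> fd.
have dl : is_derive x 1 (fun t => a + s * t) s.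
  have := @is_deriveD _ _ _ (cst a) ( *%R s) x 1 0 s _ _.
  rewrite add0r; apply.
  have := @is_deriveZ _ _ _ id s x 1 1 _; rewrite scaler1 => ?.
  exact: is_derive_eq.
have := @is_derive1_comp _ f (fun t : R => a + s * t) x d s fd dl.
by rewrite mulrC.
Qed.

Lemma smooth_affine f (a s : R) : smooth f -> smooth (fun t => f (a + s * t)).
Proof.
move=> sf k; elim: k f sf => [|k IH] f sf.
  split => // x; apply: (@continuous_comp _ _ _ (fun t => a + s * t) f).
    by apply: cvgD; [exact: cvg_cst|apply: cvgMr; exact: cvg_id].
  exact: smooth_continuous.
have dl (x : R) : is_derive x 1 (fun t : R => f (a + s * t)) (s * derive1 f (a + s * x)).
  apply: is_derive_affine; rewrite derive1E; apply: DeriveDef => //.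
  exact: smooth_derivable.
split; last split.
- by apply: derivable_continuous => x; have [] := dl x.
- by move=> x; have [] := dl x.
- rewrite (_ : derive1 _ = fun x => s * derive1 f (a + s * x)).
    apply: smoothnM; first exact: smoothn_cst.
    exact/IH/smooth_derive1.
  by apply/funext => x; rewrite derive1E; have [_ ->] := dl x.
Qed.

Lemma smoothM f g : smooth f -> smooth g -> smooth (fun x => f x * g x).
Proof. by move=> sf sg k; exact: smoothnM. Qed.

Lemma smooth_cst (c : R) : smooth (fun=> c).
Proof. by move=> k; exact: smoothn_cst. Qed.

(* The derivative of [expinv j] is a linear combination of [expinv j.+1] and
   [expinv j.+2], so the whole family is shown to be smooth simultaneously. *)
Definition expinv (j : nat) (t : R) : R :=
  if 0 < t then t^-1 ^+ j * expR (- t^-1) else 0.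

Lemma expinv_ge0 j t : 0 <= expinv j t.
Proof.
rewrite /expinv; case: ifPn => // t0; rewrite mulr_ge0 ?expR_ge0//.
by rewrite exprn_ge0// invr_ge0 ltW.
Qed.

Lemma expinv_gt0 j t : 0 < t -> 0 < expinv j t.
Proof. by move=> t0; rewrite /expinv t0 mulr_gt0 ?expR_gt0// exprn_gt0// invr_gt0. Qed.

Lemma expinv_le0 j t : t <= 0 -> expinv j t = 0.
Proof. by move=> t0; rewrite /expinv ltNge t0. Qed.

(** With s = 1/t this is s^j e^(-s) <= j!, which holds because s^j / j! is one of the terms of the
    exponential series. For j = 2 it yields the bound 2 on the derivative of the cut-off in the
    final estimate. *)
Lemma expinv_le j t : expinv j t <= j`!%:R.
Proof.
rewrite /expinv; case: ifPn => // t0.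
rewrite expRN -ler_pdivlMr ?invr_gt0 ?expR_gt0// invrK.
have s0 : 0 <= t^-1 by rewrite invr_ge0 ltW.
case: j => [|j]; first by rewrite fact0 expr0 mul1r -expR0 ler_expR.
rewrite mulrC -ler_pdivrMr ?ltr0n ?fact_gt0//.
by apply: le_trans (expR_ge1Dxn j s0); rewrite lerDr.
Qed.

(** Used twice: it gives the difference quotient at 0, and, as [expinv 2] is the derivative of
    [expinv 0], it says that the logarithmic derivative of [expinv 0] is t^(-2). *)
Lemma expinvS2 j t : expinv j t = t ^+ 2 * expinv j.+2 t.
Proof.
rewrite /expinv; case: ifPn => [t0|]; last by rewrite mulr0.
rewrite mulrA; congr (_ * _).
by rewrite (exprS _ j.+1) (exprS _ j) expr2; field; rewrite gt_eqF.
Qed.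

Lemma is_derive_expinv j (t : R) :
  is_derive t 1 (expinv j) (- j%:R * expinv j.+1 t + expinv j.+2 t).
Proof.
have [t0|t0|->] := ltgtP t 0.
- rewrite !expinv_le0 ?ltW// mulr0 addr0.
  apply: (@near_eq_is_derive _ _ _ (cst 0)).
  by near=> x; rewrite expinv_le0// ltW//; near: x; exact: lt_nbhsl.
- rewrite /expinv t0.
  apply: (@near_eq_is_derive _ _ _
    (fun t : R => t^-1 ^+ j * expR (- t^-1))).
    near=> x; rewrite ifT//; near: x; exact: lt_nbhsr.
  have dV : is_derive t 1 (fun t : R => t^-1) (- t ^- 2).
    have := @is_deriveV R id t 1 1 (lt0r_neq0 t0) (is_derive_id _ _).
    by rewrite /GRing.scale /= mulr1.
  have dE : is_derive t 1 (fun t : R => expR (- t^-1)) (t ^- 2 * expR (- t^-1)).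
    have dN := is_deriveN dV; rewrite opprK in dN.
    have := @is_derive1_comp _ expR _ t _ _ (is_derive_expR _) dN.
    by rewrite mulrC.
  have dX := is_deriveX j dV.
  have := is_deriveM dX dE.
  rewrite mulrfctE exprfctE /GRing.scale /= => dM.
  have <- : t^-1 ^+ j * (t ^- 2 * expR (- t^-1)) +
      expR (- t^-1) * (j%:R * t^-1 ^+ j.-1 * - t ^- 2) =
      - j%:R * (t^-1 ^+ j.+1 * expR (- t^-1)) + t^-1 ^+ j.+2 * expR (- t^-1).
    case: {dM dX dE} j => [|j].
      by rewrite !exprS !expr0; field; rewrite gt_eqF.
    by rewrite /= !exprS expr0; field; rewrite gt_eqF.
  exact: dM.
- rewrite !expinv_le0 // mulr0 addr0.
  (* At 0 the difference quotient equals [h * expinv j.+2 h], which is at most [(j+2)!] times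
     [|h|]. *)
  have H : (fun h : R => h^-1 *: (expinv j (h *: 1 + 0) - expinv j 0)) @ 0^' --> (0 : R).
    apply/cvgr0Pnorm_le => e e0.
    have C0 : 0 < j.+2`!%:R :> R by rewrite ltr0n fact_gt0.
    near=> h.
    rewrite (expinv_le0 _ (lexx 0)) subr0 addr0 [X in expinv j X]mulr1 expinvS2.
    have h0 : h != 0 by near: h; exact: nbhs_dnbhs_neq.
    rewrite /GRing.scale /= mulrA expr2 mulKf// normrM (ger0_norm (expinv_ge0 _ _)).
    apply: le_trans (ler_wpM2l (normr_ge0 _) (expinv_le _ _)) _.
    rewrite -ler_pdivlMr//.
    near: h; apply: dnbhs0_le; exact: divr_gt0.
  apply: DeriveDef.
    by apply/cvg_ex; exists 0.
  exact/cvg_lim.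
Unshelve. all: end_near.
Qed.

Lemma smooth_expinv j : smooth (expinv j).
Proof.
move=> k; elim: k j => [|k IH] j.
  split => //; apply: derivable_continuous => x.
  by have [] := is_derive_expinv j x.
split; first by apply: derivable_continuous => x; have [] := is_derive_expinv j x.
split; first by move=> x; have [] := is_derive_expinv j x.
rewrite (_ : derive1 _ = fun t => - j%:R * expinv j.+1 t + expinv j.+2 t).
  by apply: smoothnD => //; apply: smoothnM => //; exact: smoothn_cst.
by apply/funext => t; rewrite derive1E; have [_ ->] := is_derive_expinv j t.
Qed.

Lemma expinv0_homo (s t : R) : s <= t -> expinv 0 s <= expinv 0 t.
Proof.
move=> st; have [s0|s0] := leP s 0; first by rewrite expinv_le0// expinv_ge0.
have t0 := lt_le_trans s0 st.
by rewrite /expinv s0 t0 !expr0 !mul1r ler_expR lerN2 lef_pV2.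
Qed.

(** * Bump functions and mollifiers on the line *)

Definition bump (r t : R) : R := expinv 0 (r - t) * expinv 0 (r + t).

Lemma smooth_bump r : smooth (bump r).
Proof.
apply: smoothM.
  rewrite (_ : (fun _ => _) = (fun t : R => expinv 0 (r + (-1) * t))).
    by apply: smooth_affine; exact: smooth_expinv.
  by apply/funext => t; rewrite mulN1r.
rewrite (_ : (fun _ => _) = (fun t : R => expinv 0 (r + 1 * t))).
  by apply: smooth_affine; exact: smooth_expinv.
by apply/funext => t; rewrite mul1r.
Qed.

Lemma bump_ge0 r t : 0 <= bump r t.
Proof. by rewrite mulr_ge0// expinv_ge0. Qed.

Lemma bump_le1 r t : bump r t <= 1.
Proof.
by rewrite -[leRHS]mulr1 ler_pM ?expinv_ge0// (le_trans (expinv_le _ _))// fact0.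
Qed.

Lemma bump_eq0 r t : r <= `|t| -> bump r t = 0.
Proof.
rewrite ler_normr /bump => /orP[h|h].
  by rewrite expinv_le0 ?mul0r// subr_le0.
by rewrite mulrC expinv_le0 ?mul0r//; lra.
Qed.

Lemma bumpN r t : bump r (- t) = bump r t.
Proof. by rewrite /bump opprK mulrC. Qed.

Lemma bump_ge r s t : `|t| <= s -> expinv 0 (r - s) ^+ 2 <= bump r t.
Proof.
rewrite ler_norml => /andP[h1 h2]; rewrite expr2.
by apply: ler_pM; rewrite ?expinv_ge0//; apply: expinv0_homo; lra.
Qed.

(** Makes the normalisation in [mol1] legitimate. The bump is squeezed between a positive multiple
    of the indicator of [-r/2, r/2] and the indicator of [-r, r]. *)
Lemma bump_integral r : 0 < r ->
  (0 < \int[@lebesgue_measure R]_t (bump r t)%:E < +oo)%E.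
Proof.
move=> r0; set mu := lebesgue_measure.
have mb : measurable_fun [set: R] (EFin \o bump r).
  apply/measurable_EFinP; apply: continuous_measurable_fun.
  exact: smooth_continuous (smooth_bump r).
have mi (a b : R) (c : R) : (\int[mu]_t (c * \1_`[a, b] t)%:E = c%:E * mu `[a, b]%classic)%E.
  under eq_integral do rewrite EFinM.
  rewrite integralZl//; first by rewrite integral_indic// setIT.
  exact: integrable_indic_itv.
apply/andP; split.
  apply: (@lt_le_trans _ _ (\int[mu]_t (expinv 0 (r - r / 2) ^+ 2 * \1_`[- (r/2), r/2] t)%:E)%E).
    rewrite mi /mu lebesgue_measure_itv/= lte_fin ifT; last by lra.
    rewrite -EFinB -EFinM lte_fin mulr_gt0//; last by lra.
    by rewrite exprn_gt0// expinv_gt0//; lra.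
  apply: ge0_le_integral => //.
  - by move=> t _; rewrite lee_fin mulr_ge0// ?exprn_ge0 ?expinv_ge0.
  - by apply/measurable_EFinP; apply: measurable_funM => //; exact: measurable_indic.
  - move=> t _; rewrite lee_fin indicE; case: (boolP (_ \in _)) => ht; last by rewrite mulr0 bump_ge0.
    rewrite mulr1; apply: bump_ge; move: ht; rewrite inE/= in_itv/= => /andP[? ?].
    by rewrite ler_norml; apply/andP.
apply: (@le_lt_trans _ _ (\int[mu]_t (1 * \1_`[- r, r] t)%:E)%E).
  apply: ge0_le_integral => //.
  - by move=> t _; rewrite lee_fin bump_ge0.
  - by apply/measurable_EFinP; apply: measurable_funM => //; exact: measurable_indic.
  - move=> t _; rewrite lee_fin mul1r indicE; case: (boolP (_ \in _)) => ht; first exact: bump_le1.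
    rewrite bump_eq0//; move: ht; rewrite notin_setE/= in_itv/= => /negP; rewrite negb_and -!ltNge => /orP[h|h].
      by rewrite ler_normr; apply/orP; right; lra.
    by rewrite ler_normr; apply/orP; left; lra.
rewrite mi /mu lebesgue_measure_itv/=; case: ifP => _; last by rewrite mule0.
by rewrite -EFinB -EFinM ltry.
Qed.

Lemma ge0_integral_shift (f : R -> R) (y : R) : continuous f -> (forall x, 0 <= f x) ->
  (\int[@lebesgue_measure R]_x (f (x - y))%:E = \int[@lebesgue_measure R]_x (f x)%:E)%E.
Proof.
move=> cf f0.
have dF (x : R) : is_derive x 1 (fun x : R => x - y) 1.
  have := @is_deriveB _ _ _ id (cst y) x 1 1 0 _ _.
  by rewrite subr0; apply.
have dFE : derive1 (fun x : R => x - y) = cst 1.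
  by apply/funext => x; rewrite derive1E; have [_ ->] := dF x.
rewrite [RHS](@increasing_ge0_integration_by_substitutionT _ (fun x => x - y))//.
- by rewrite dFE; apply: eq_integral => x _; rewrite mulrfctE /= mulr1.
- by move=> a b ab; rewrite ltrD2r.
- by rewrite dFE => x; exact: cvg_cst.
- by rewrite dFE; apply: is_cvg_cst.
- by rewrite dFE; apply: is_cvg_cst.
- apply/cvgrNyPle => A; near=> x. 
  rewrite lerBlDr; near: x; apply: nbhs_ninfty_le; exact: num_real.
- apply/cvgryPge => A; near=> x.
  rewrite lerBrDr; near: x; apply: nbhs_pinfty_ge; exact: num_real.
Unshelve. all: end_near. Qed.

Definition mol1 (r t : R) : R := (fine (\int[@lebesgue_measure R]_t (bump r t)%:E))^-1 * bump r t.

Lemma smooth_mol1 r : smooth (mol1 r).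
Proof. by apply: smoothM (smooth_bump r); exact: smooth_cst. Qed.

Lemma mol1_ge0 r t : 0 <= mol1 r t.
Proof.
rewrite mulr_ge0 ?bump_ge0// invr_ge0 fine_ge0//.
by apply: integral_ge0 => x _; rewrite lee_fin bump_ge0.
Qed.

Lemma mol1_eq0 r t : r <= `|t| -> mol1 r t = 0.
Proof. by move=> h; rewrite /mol1 bump_eq0// mulr0. Qed.

Lemma mol1N r t : mol1 r (- t) = mol1 r t.
Proof. by rewrite /mol1 bumpN. Qed.

Lemma mol1_ge r s : 0 < r -> s < r ->
  exists2 c : R, 0 < c & forall t, `|t| <= s -> c <= mol1 r t.
Proof.
move=> r0 sr; have /andP[i0 ioo] := bump_integral r0.
have fi : 0 < fine (\int[@lebesgue_measure R]_t (bump r t)%:E) by rewrite fine_gt0// i0 ioo.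
exists ((fine (\int[@lebesgue_measure R]_t (bump r t)%:E))^-1 * expinv 0 (r - s) ^+ 2).
  by rewrite mulr_gt0 ?invr_gt0// exprn_gt0// expinv_gt0// subr_gt0.
by move=> t ts; rewrite ler_wpM2l ?invr_ge0 ?(ltW fi)//; exact: bump_ge.
Qed.

Lemma mol1_integral r y : 0 < r ->
  (\int[@lebesgue_measure R]_x (mol1 r (x - y))%:E = 1)%E.
Proof.
move=> r0; rewrite (@ge0_integral_shift (mol1 r)); last 2 first.
- exact: smooth_continuous (smooth_mol1 r).
- exact: mol1_ge0.
rewrite /mol1; have /andP[i0 ioo] := bump_integral r0.
have ifin : (\int[@lebesgue_measure R]_t (bump r t)%:E)%E \is a fin_num.
  by rewrite ge0_fin_numE// ltW.
under eq_integral do rewrite EFinM.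
rewrite ge0_integralZl//.
- rewrite -[X in (_ * X)%E](fineK ifin) -EFinM mulVf// gt_eqF// fine_gt0// i0//=.
- apply/measurable_EFinP; apply: continuous_measurable_fun.
  exact: smooth_continuous (smooth_bump r).
- by move=> t _; rewrite lee_fin bump_ge0.
- by rewrite lee_fin invr_ge0 fine_ge0// ltW.
Qed.

End smooth1.

(** * Borel structure and Lebesgue measure on R^N *)

Section measure_rV.
Context {R : realType}.

Lemma rV_norm_lt N (x : 'rV[R]_N) (e : R) : 0 < e ->
  (forall i, `|x ord0 i| < e) -> `|x| < e.
Proof.
move=> e0 h; have := mx_norm_ball; move=> /(_ R 1%N N) E.
suff : ball (0 : 'rV[R]_N) e x.
  by rewrite E /ball_ /= sub0r normrN.
by split => // i j; rewrite mxE /ball /= sub0r normrN ord1; exact: h.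
Qed.

Lemma rV_coord_le N (x : 'rV[R]_N) i : `|x ord0 i| <= `|x|.
Proof.
apply/ler_addgt0Pr => d d0; apply: ltW; set e := `|x| + d.
have e1 : `|x| < e by rewrite ltrDl.
have : ball (0 : 'rV[R]_N) e x by rewrite mx_norm_ball /ball_ /= sub0r normrN.
by case=> _ /(_ ord0 i); rewrite mxE /ball /= sub0r normrN.
Qed.

(** The sigma-algebra is generated by the coordinates, so an open set is written as a countable
    union of boxes with rational centres and half-sides 1/(k+1). Boxes that are not included in [U]
    are replaced by the empty set, which keeps the index type countable without selecting a subset
    of it. *)
Lemma measurable_open_rV N (U : set 'rV[R]_N) : open U -> measurable U.
Proof.
move=> oU.
pose box (z : 'rV[rat]_N * nat) : set 'rV[R]_N :=
  [set y | forall i, `|y ord0 i - ratr (z.1 ord0 i)| < z.2.+1%:R^-1].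
pose F z := if `[< box z `<=` U >] then box z else set0.
have -> : U = \bigcup_z F z.
  apply/seteqP; split => [x Ux|x [z _]]; last first.
    by rewrite /F; case: asboolP => // h /h.
  have /nbhs_ballP[e /= e0 xU] := oU x Ux.
  (* Half of [e]: [x] and [y] are both within 1/(k+1) of the rational centre in each coordinate,
     hence within [e] of each other. *)
  have [k ke] : exists k : nat, k.+1%:R^-1 < e / 2.
    have e20 : 0 < e / 2 by rewrite divr_gt0.
    exists (Num.trunc (e / 2)^-1); rewrite invf_plt ?posrE//.
    exact: truncnS_gt.
  have [d dE] : exists d : R, d = k.+1%:R^-1 by eexists.
  have d0 : 0 < d by rewrite dE invr_gt0.
  have /choice[q hq] : forall i, exists q : rat, `|x ord0 i - ratr q| < k.+1%:R^-1.
    move=> i; rewrite -dE.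
    have [|q] := @rat_in_itvoo R (x ord0 i - d) (x ord0 i + d); first by lra.
    by rewrite in_itv/= => /andP[h1 h2]; exists q; rewrite ltr_norml; lra.
  exists (\row_i q i, k) => //; rewrite /F asboolT.
    by move=> i /=; rewrite mxE; exact: hq.
  move=> y hy; apply: xU; rewrite mx_norm_ball /ball_ /=; apply: rV_norm_lt => // i.
  rewrite !mxE; have := hq i; have := hy i; rewrite /= mxE -dE; rewrite -dE in ke; move: (ratr _) => t.
  rewrite !ltr_norml; lra.
apply: countable_bigcupT_measurable => [|z]; first exact: countableP.
rewrite /F; case: asboolP => // _.
rewrite (_ : box z = \bigcap_(i in [set: 'I_N]) [set y : 'rV[R]_N | `|y ord0 i - ratr (z.1 ord0 i)| < z.2.+1%:R^-1]).
  apply: fin_bigcap_measurable => // i _.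
  pose B := [set t : R | `|t - ratr (z.1 ord0 i)| < z.2.+1%:R^-1].
  have mB : measurable B.
    rewrite (_ : B = `]ratr (z.1 ord0 i) - z.2.+1%:R^-1, ratr (z.1 ord0 i) + z.2.+1%:R^-1[%classic)//.
    apply/seteqP; split => t; rewrite /B /= in_itv/= ltr_norml; move: (_^-1) (ratr _) => d q; lra.
  have := @measurable_coord R N i measurableT _ mB.
  by rewrite setTI.
by apply/seteqP; split => [y h i _|y h i]; [exact: h|exact: (h i)].
Qed.

Lemma measurable_fun_continuous_rV N (f : 'rV[R]_N -> R) :
  continuous f -> measurable_fun setT f.
Proof.
move=> cf; apply: (measurability _ (RGenOInfty.measurableE R)).
move=> /= _ [_ [a ->] <-]; rewrite setTI; apply: measurable_open_rV.
by apply: open_comp => //; exact: open_gt.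
Qed.

(** A tensor product instead of a radial function: its support is a ball of the sup norm, and its
    integral and its derivatives reduce to one coordinate at a time. *)
Definition mol N (r : R) (x : 'rV[R]_N) : R := \prod_(i < N) mol1 r (x ord0 i).

Lemma mol_ge0 N r (x : 'rV[R]_N) : 0 <= mol r x.
Proof. by apply: prodr_ge0 => i _; exact: mol1_ge0. Qed.

Lemma molN N r (x : 'rV[R]_N) : mol r (- x) = mol r x.
Proof. by apply: eq_bigr => i _; rewrite mxE mol1N. Qed.

Lemma mol_eq0 N r (x : 'rV[R]_N) : 0 < r -> r <= `|x| -> mol r x = 0.
Proof.
move=> r0 rx; have [[i hi]|h] := pselect (exists i, r <= `|x ord0 i|).
  by rewrite /mol (bigD1 i)//= mol1_eq0// mul0r.
have : `|x| < r.
  by apply: rV_norm_lt => // i; rewrite ltNge; apply/negP => hi; apply: h; exists i.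
by rewrite ltNge rx.
Qed.

Lemma continuous_prod_coord N (f : 'I_N -> R -> R) :
  (forall i, continuous (f i)) -> continuous (fun x : 'rV[R]_N => \prod_(i < N) f i (x ord0 i)).
Proof.
move=> cf; elim: (index_enum _) => [|i s IH] x.
  rewrite (_ : (fun _ => _) = cst 1); first exact: cst_continuous.
  by apply/funext => y; rewrite big_nil.
rewrite (_ : (fun _ => _) = fun y : 'rV[R]_N => f i (y ord0 i) * \prod_(j <- s) f j (y ord0 j)); last first.
  by apply/funext => y; rewrite big_cons.
apply: continuousM; last exact: IH.
have cfi : continuous (f i \o (fun x : 'rV[R]_N => x ord0 i)).
  by move=> y; apply: continuous_comp; [exact: coord_continuous|exact: cf].
exact: cfi.
Qed.

Lemma continuous_mol N r : continuous (@mol N r).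
Proof.
by apply: (@continuous_prod_coord N (fun=> mol1 r)) => i; exact: smooth_continuous (smooth_mol1 r).
Qed.

(** Tonelli's theorem carried through the pushforward by which [lebesgueN] is defined; it makes
    inductions on the dimension possible. *)
Lemma ge0_integral_lebesgueS N (f : 'rV[R]_N.+1 -> \bar R) :
  measurable_fun setT f -> (forall x, 0 <= f x)%E ->
  (\int[lebesgueN N.+1]_x f x =
   \int[lebesgue_measure]_t \int[lebesgueN N]_v f (cons_row (t, v)))%E.
Proof.
move=> mf f0.
rewrite (@ge0_integral_pushforward _ _ _ _ _ _ (@measurable_cons_row R N) _ setT f)//.
rewrite preimage_setT fubini_tonelli1//.
  by apply: measurableT_comp => //; exact: measurable_cons_row.
by move=> x; exact: f0.
Qed.

Lemma continuous_subr N (y : 'rV[R]_N) : continuous (fun x : 'rV[R]_N => x - y).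
Proof. by move=> x; apply: continuousB; [exact: cvg_id|exact: cst_continuous]. Qed.

Lemma measurable_mol N r (y : 'rV[R]_N) :
  measurable_fun setT (fun x : 'rV[R]_N => mol r (x - y)).
Proof.
have c : continuous (@mol N r \o (fun x => x - y)).
  by move=> x; apply: continuous_comp; [exact: continuous_subr|exact: continuous_mol].
exact: measurable_fun_continuous_rV c.
Qed.

(** Induction on the dimension: the first factor integrates to 1 by [mol1_integral]. In dimension 0
    the measure is a Dirac mass and the product is empty. *)
Lemma mol_integral N r (y : 'rV[R]_N) : 0 < r ->
  (\int[lebesgueN N]_x (mol r (x - y))%:E = 1)%E.
Proof.
move=> r0; elim: N y => [|N IH] y.
  rewrite /= integral_dirac//; last by apply/measurable_EFinP; exact: measurable_mol.
  by rewrite diracT mul1e /mol big_ord0.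
rewrite ge0_integral_lebesgueS; last 2 first.
- by apply/measurable_EFinP; exact: measurable_mol.
- by move=> x; rewrite lee_fin mol_ge0.
rewrite -(mol1_integral (y ord0 ord0) r0); apply: eq_integral => t _.
transitivity (\int[lebesgueN N]_v ((mol1 r (t - y ord0 ord0))%:E * (mol r (v - \row_k y ord0 (lift ord0 k)))%:E))%E.
  apply: eq_integral => v _; rewrite /mol big_ord_recl !mxE unlift_none /= -EFinM.
  by congr ((_ * _)%:E); apply: eq_bigr => i _; rewrite !mxE liftK.
rewrite ge0_integralZl//.
- by rewrite IH mule1.
- by apply/measurable_EFinP; exact: measurable_mol.
- by move=> v _; rewrite lee_fin mol_ge0.
- by rewrite lee_fin mol1_ge0.
Qed.

Lemma mol_integralr N r (y : 'rV[R]_N) : 0 < r ->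
  (\int[lebesgueN N]_x (mol r (y - x))%:E = 1)%E.
Proof.
by move=> r0; rewrite -(mol_integral y r0); apply: eq_integral => x _; rewrite -molN opprB.
Qed.

Lemma mol_ge N r s : 0 < r -> s < r ->
  exists2 c : R, 0 < c & forall x : 'rV[R]_N, `|x| <= s -> c <= mol r x.
Proof.
move=> r0 sr; have [c c0 hc] := mol1_ge r0 sr.
exists (c ^+ N); first exact: exprn_gt0.
move=> x xs; rewrite -[in leLHS](card_ord N) -prodr_const.
apply: ler_prod => i _; rewrite ltW//= hc//.
exact: le_trans (rV_coord_le _ _) xs.
Qed.

Lemma mol_le N r : exists2 C : R, 0 < C & forall x : 'rV[R]_N, mol r x <= C.
Proof.
pose c := (fine (\int[@lebesgue_measure R]_t (bump r t)%:E))^-1.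
exists ((c + 1) ^+ N).
  rewrite exprn_gt0// ltr_wpDl// invr_ge0 fine_ge0//.
  by apply: integral_ge0 => x _; rewrite lee_fin bump_ge0.
move=> x; rewrite -[in leRHS](card_ord N) -prodr_const.
apply: ler_prod => i _; rewrite mol1_ge0/= /mol1 -/c.
have c0 : 0 <= c.
  rewrite invr_ge0 fine_ge0//.
  by apply: integral_ge0 => t _; rewrite lee_fin bump_ge0.
have := bump_le1 r (x ord0 i); have := bump_ge0 r (x ord0 i); nra.
Qed.

Lemma closed_norm_le N (M : R) : closed [set x : 'rV[R]_N | `|x| <= M].
Proof.
rewrite (_ : [set x | _] = (fun x : 'rV[R]_N => `|x|) @^-1` [set t | t <= M])//.
apply: preimage_closed; first by move=> x _; exact: norm_continuous.
exact: closed_le.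
Qed.

(* Comparing an indicator function with a multiple of a mollifier bounds the
   measure of balls from both sides, as mollifiers have integral 1. *)
Lemma lebesgueN_ball_lty N (M : R) : (lebesgueN N [set x : 'rV[R]_N | (`|x| <= M)%R] < +oo)%E.
Proof.
have M0 : (0 < `|M| + 1)%R by rewrite ltr_wpDl.
have [|c c0 hc] := @mol_ge N (`|M| + 1)%R `|M| M0 _.
  by rewrite ltrDl.
have mB : measurable [set x : 'rV[R]_N | (`|x| <= M)%R].
  rewrite -[X in measurable X]setCK; apply: measurableC; apply: measurable_open_rV.
  rewrite openC.
  exact: closed_norm_le.
have : (c%:E * lebesgueN N [set x : 'rV[R]_N | (`|x| <= M)%R] <= 1)%E.
  rewrite -(@mol_integral N (`|M| + 1)%R 0 M0).
  rewrite -integral_cst//.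
  rewrite integral_mkcond; apply: ge0_le_integral => //.
  - move=> x _; rewrite patchE; case: ifP => // _; rewrite lee_fin; exact: ltW.
  - by apply/(measurable_restrictT _ _).1.
  - by apply/measurable_EFinP; exact: measurable_mol.
  - move=> x _; rewrite patchE; case: ifPn => hx; last by rewrite lee_fin mol_ge0.
    rewrite lee_fin hc// subr0; move: hx; rewrite inE/= => h.
    exact: le_trans h (ler_norm _).
move=> h; rewrite -(@lte_pmul2l _ c%:E) ?lte_fin//.
by apply: le_lt_trans h _; rewrite gt0_muley ?lte_fin// ltry.
Qed.

Lemma lebesgueN_ball_gt0 N (x : 'rV[R]_N) (r : R) : 0 < r ->
  (0 < lebesgueN N (ball x r))%E.
Proof.
move=> r0; have mB : measurable (ball x r) by apply: measurable_open_rV; apply: ball_open.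
rewrite lt0e measure_ge0 andbT; apply/eqP => b0.
have [C C0 hC] := @mol_le N r.
have : (\int[lebesgueN N]_y (mol r (y - x))%:E <= C%:E * lebesgueN N (ball x r))%E.
  rewrite -integral_cst//.
  rewrite [leRHS]integral_mkcond; apply: ge0_le_integral => //.
  - by move=> y _; rewrite lee_fin mol_ge0.
  - by apply/measurable_EFinP; exact: measurable_mol.
  - by apply/(measurable_restrictT _ _).1.
  - move=> y _; rewrite patchE; case: ifPn => hy; first by rewrite lee_fin.
    rewrite mol_eq0//; move: hy; rewrite notin_setE mx_norm_ball /ball_ /= => /negP.
    by rewrite -leNgt distrC.
by rewrite mol_integral// b0 mule0 lee_fin ler10.
Qed.

End measure_rV.

(** * Smooth functions of several variables *)

Section Cinfty_theory.
Context {R : realType} {N : nat}.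
Implicit Types f g : 'rV[R]_N -> R.
Local Notation delta i := (delta_mx ord0 i : 'rV[R]_N).

(** Both sides are limits of the same difference quotient. One-variable rules thus pass to partial
    derivatives with no recourse to Fréchet differentiability. *)
Lemma is_derive_line f (x v : 'rV[R]_N) (d : R) :
  is_derive x v f d <-> is_derive (0 : R) 1 (fun t : R => f (t *: v + x)) d.
Proof.
have E : (fun h : R => h^-1 *: (f (h *: v + x) - f x)) =
  (fun h : R => h^-1 *: (f ((h *: 1 + 0) *: v + x) - f (0 *: v + x))).
  by apply/funext => h; rewrite scale0r add0r addr0 [in RHS]/GRing.scale/= mulr1.
split=> -[dv dE]; apply: DeriveDef.
- by move: dv; rewrite /derivable E.
- by move: dE; rewrite /derive E.
- by move: dv; rewrite /derivable -E.
- by move: dE; rewrite /derive -E.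
Qed.

Lemma is_derive_comp1 (F : R -> R) f (x v : 'rV[R]_N) (d e : R) :
  is_derive x v f d -> is_derive (f x) 1 F e -> is_derive x v (F \o f) (e * d).
Proof.
move=> /is_derive_line fd Fe; apply/is_derive_line.
have Fe' : is_derive (f (0 *: v + x)) 1 F e by rewrite scale0r add0r.
exact: (@is_derive1_comp _ F (fun t : R => f (t *: v + x)) _ _ _ Fe' fd).
Qed.

Lemma is_derive_reflect f (x y v : 'rV[R]_N) (d : R) :
  is_derive (x - y) v f d -> is_derive y v (fun y => f (x - y)) (- d).
Proof.
move=> /is_derive_line fd; apply/is_derive_line.
have fd' : is_derive (0 + (-1) * 0 : R) 1 (fun t : R => f (t *: v + (x - y))) d.
  by rewrite mulr0 addr0.
have := is_derive_affine fd'; rewrite mulN1r.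
rewrite (_ : (fun t : R => f ((0 + -1 * t) *: v + (x - y))) = (fun t : R => f (x - (t *: v + y))))//.
by apply/funext => t; congr f; rewrite add0r mulN1r scaleNr opprD addrCA.
Qed.

Lemma is_derive_partial i f x : derivable f x (delta i) ->
  is_derive x (delta i) f (partial i f x).
Proof. by move=> df; apply: DeriveDef. Qed.

Lemma CnW k f : Cn k.+1 f -> Cn k f.
Proof.
elim: k f => [|k IH] f [cf df]; first by split.
by split => // i; have [df1 df2] := df i; split => //; exact: IH.
Qed.

Lemma Cn_continuous k f : Cn k f -> continuous f.
Proof. by case: k => [|k] []. Qed.

Lemma CnS k f (F : 'I_N -> 'rV[R]_N -> R) : continuous f ->
  (forall i x, is_derive x (delta i) f (F i x)) -> (forall i, Cn k (F i)) -> Cn k.+1 f.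
Proof.
move=> cf df cF; split => // i; split; first by move=> x; have [] := df i x.
rewrite (_ : partial i f = F i)//.
by apply/funext => x; rewrite /partial; have [_ ->] := df i x.
Qed.

Lemma Cn_is_derive k f i x : Cn k.+1 f -> is_derive x (delta i) f (partial i f x).
Proof. by move=> [_ /(_ i)[df _]]; exact: is_derive_partial. Qed.

Lemma Cn_partial k f i : Cn k.+1 f -> Cn k (partial i f).
Proof. by move=> [_ /(_ i)[]]. Qed.

Lemma CnD k f g : Cn k f -> Cn k g -> Cn k (fun x => f x + g x).
Proof.
elim: k f g => [|k IH] f g cf cg.
  by split => // x; apply: continuousD; [exact: Cn_continuous cf x|exact: Cn_continuous cg x].
apply: (@CnS _ _ (fun i x => partial i f x + partial i g x)).
- by move=> x; apply: continuousD; [exact: Cn_continuous cf x|exact: Cn_continuous cg x].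
- by move=> i x; exact: is_deriveD (Cn_is_derive i x cf) (Cn_is_derive i x cg).
- by move=> i; apply: IH; exact: Cn_partial.
Qed.

Lemma CnM k f g : Cn k f -> Cn k g -> Cn k (fun x => f x * g x).
Proof.
elim: k f g => [|k IH] f g cf cg.
  by split => // x; apply: continuousM; [exact: Cn_continuous cf x|exact: Cn_continuous cg x].
apply: (@CnS _ _ (fun i x => f x * partial i g x + g x * partial i f x)).
- by move=> x; apply: continuousM; [exact: Cn_continuous cf x|exact: Cn_continuous cg x].
- by move=> i x; exact: is_deriveM (Cn_is_derive i x cf) (Cn_is_derive i x cg).
- by move=> i; apply: CnD; apply: IH; try exact: CnW; exact: Cn_partial.
Qed.

Lemma Cn_comp k (F : R -> R) f : smooth F -> Cn k f -> Cn k (F \o f).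
Proof.
elim: k F f => [|k IH] F f sF cf.
  split => // x; apply: continuous_comp; first exact: Cn_continuous cf x.
  exact: smooth_continuous.
apply: (@CnS _ _ (fun i x => (derive1 F \o f) x * partial i f x)).
- move=> x; apply: continuous_comp; first exact: Cn_continuous cf x.
  exact: smooth_continuous.
- move=> i x; apply: is_derive_comp1; first exact: Cn_is_derive cf.
  by rewrite /= derive1E; apply: DeriveDef => //; exact: smooth_derivable.
- move=> i; apply: CnM; last exact: Cn_partial.
  by apply: IH; [exact: smooth_derive1|exact: CnW].
Qed.

Lemma partial_comp (F : R -> R) f i x : smooth F -> Cn 1 f ->
  partial i (F \o f) x = derive1 F (f x) * partial i f x.
Proof.
move=> sF cf.
have dF : is_derive (f x) 1 F (derive1 F (f x)).
  by rewrite /= derive1E; apply: DeriveDef => //; exact: smooth_derivable.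
by have [_] := is_derive_comp1 (Cn_is_derive i x cf) dF.
Qed.

(** The derivative is again written as a product over the coordinates, with one factor replaced;
    this is the form on which the induction of [Cn_prod_coord] runs. *)
Lemma is_derive_prod_coord (F : 'I_N -> R -> R) j (x : 'rV[R]_N) :
  (forall i, smooth (F i)) ->
  is_derive x (delta j) (fun x => \prod_(i < N) F i (x ord0 i))
    (\prod_(i < N) (if i == j then derive1 (F i) else F i) (x ord0 i)).
Proof.
move=> sF; apply/is_derive_line.
pose c := \prod_(i < N | i != j) F i (x ord0 i).
rewrite (_ : (fun t => _) = (fun t : R => c * F j (x ord0 j + 1 * t))); last first.
  apply/funext => t; rewrite (bigD1 j)//= mulrC; congr (_ * _).
    by apply: eq_bigr => i /negbTE ij; rewrite !mxE ij andbF mulr0 add0r.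
  by rewrite !mxE !eqxx mulr1 mul1r addrC.
rewrite (bigD1 j)//= eqxx mulrC.
rewrite (_ : \prod_(i < N | i != j) _ = c); last first.
  by apply: eq_bigr => i /negbTE ->.
have dF : is_derive (x ord0 j + 1 * 0) 1 (F j) (derive1 (F j) (x ord0 j)).
  rewrite mulr0 addr0 derive1E; apply: DeriveDef => //; exact: smooth_derivable.
have := is_derive_affine dF; rewrite mul1r => dF'.
exact: (is_deriveZ c dF').
Qed.

Lemma Cn_prod_coord k (F : 'I_N -> R -> R) : (forall i, smooth (F i)) ->
  Cn k (fun x : 'rV[R]_N => \prod_(i < N) F i (x ord0 i)).
Proof.
elim: k F => [|k IH] F sF.
  split => //; apply: continuous_prod_coord => i; exact: smooth_continuous.
apply: (@CnS _ _ (fun j x => \prod_(i < N) (if i == j then derive1 (F i) else F i) (x ord0 i))).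
- apply: continuous_prod_coord => i; exact: smooth_continuous.
- by move=> j x; exact: is_derive_prod_coord.
- move=> j; apply: (IH (fun i => if i == j then derive1 (F i) else F i)) => i; case: ifP => // _; exact: smooth_derive1.
Qed.

Lemma Cinfty_mol r : Cinfty (@mol R N r).
Proof. by move=> k; apply: (@Cn_prod_coord k (fun=> mol1 r)) => i; exact: smooth_mol1. Qed.

Lemma Cinfty_mol_reflect r x : Cinfty (fun y : 'rV[R]_N => mol r (x - y)).
Proof.
move=> k.
rewrite (_ : (fun _ => _) = (fun y : 'rV[R]_N => \prod_(i < N) mol1 r (x ord0 i + (-1) * y ord0 i))).
  apply: (@Cn_prod_coord k (fun i t => mol1 r (x ord0 i + (-1) * t))) => i.
  by apply: smooth_affine; exact: smooth_mol1.
by apply/funext => y; apply: eq_bigr => i _; rewrite !mxE mulN1r.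
Qed.

Lemma partial_mol_reflect r x y i :
  partial i (fun y : 'rV[R]_N => mol r (x - y)) y = - partial i (@mol R N r) (x - y).
Proof.
have := is_derive_reflect (Cn_is_derive i (x - y) (Cinfty_mol r 1)).
by case.
Qed.

(** The set where [r < |x|] is open, so [f] is constant near each of its points. This is why
    supports are described with a strict inequality. *)
Lemma partial_eq0 f i r : (forall x, r < `|x| -> f x = 0) ->
  forall x, r < `|x| -> partial i f x = 0.
Proof.
move=> f0 x rx; rewrite /partial.
have : is_derive x (delta i) f 0.
  apply: (@near_eq_is_derive _ _ _ (cst 0)).
  near=> y; rewrite f0//; near: y.
  apply: (@cvgr_gt _ _ _ _ (fun x : 'rV[R]_N => `|x|)); last exact: rx.
  exact: norm_continuous.
by case.
Unshelve. all: end_near. Qed.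

Lemma compact_support_bounded f r : continuous f -> (forall x, r < `|x| -> f x = 0) ->
  exists2 C, 0 <= C & forall x, `|f x| <= C.
Proof.
move=> cf f0.
have cB : compact [set x : 'rV[R]_N | `|x| <= `|r|].
  apply: bounded_closed_compact.
    exists `|r|; split => // t rt x /= xr; apply: le_trans xr (ltW rt).
  exact: closed_norm_le.
have cnf : {within [set x : 'rV[R]_N | `|x| <= `|r|], continuous (fun x => `|f x|)}.
  apply: continuous_subspaceT => x.
  by apply: continuous_comp; [exact: cf|exact: norm_continuous].
have [|c _ hc] := compact_EVT_max _ cB cnf; first by exists 0; rewrite /= normr0.
exists `|f c| => // x; have [xr|xr] := leP `|x| `|r|; first by apply: hc; rewrite inE.
by rewrite f0 ?normr0// (le_lt_trans (ler_norm r)).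
Qed.

(** Heine-Cantor on the ball of radius [|r| + 1], through the near-covering form of compactness. If
    [x] lies outside that ball and [|x - y| < 1], then [y] also lies outside the support and both
    values vanish. *)
Lemma compact_support_unif f r : continuous f -> (forall x, r < `|x| -> f x = 0) ->
  forall e, 0 < e -> exists2 d, 0 < d & forall x y, `|x - y| < d -> `|f x - f y| < e.
Proof.
move=> cf f0 e e0.
have cB : compact [set x : 'rV[R]_N | `|x| <= `|r| + 1].
  apply: bounded_closed_compact.
    exists (`|r| + 1); split => // t rt x /= xr; apply: le_trans xr (ltW rt).
  exact: closed_norm_le.
pose P (d : R) (x : 'rV[R]_N) := forall y, `|x - y| < d -> `|f x - f y| < e.
have /compact_near_coveringP nc := cB.
have : \forall d \near 0^'+, [set x : 'rV[R]_N | `|x| <= `|r| + 1] `<=` P d.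
  apply: nc => x _.
  have e20 : 0 < e / 2 by rewrite divr_gt0.
  have /cvgrPdist_lt/(_ _ e20)/nbhs_ballP[d /= d0 hd] := cf x.
  exists (ball x (d / 2), [set t : R | t < d / 2]).
    split => /=; first by apply: nbhsx_ballx; rewrite divr_gt0.
    apply: nbhs_right_lt; by rewrite divr_gt0.
  move=> [x' t] [/= hx' ht] y hy.
  have h1 : `|f x - f x'| < e / 2 by apply: hd; apply: le_ball hx'; lra.
  have h2 : `|f x - f y| < e / 2.
    apply: hd; rewrite mx_norm_ball /ball_ /= in hx' *.
    rewrite -(subrKA x'); apply: le_lt_trans (ler_normD _ _) _.
    lra.
  rewrite -(subrKA (f x)); apply: le_lt_trans (ler_normD _ _) _.
  rewrite (distrC (f x')); lra.
move=> h; have [d [d0 d1 hd]] : exists d : R, [/\ 0 < d, d < 1 & [set x : 'rV[R]_N | `|x| <= `|r| + 1] `<=` P d].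
  near (0:R)^'+ => d; exists d; split.
  - near: d; exact: nbhs_right_gt.
  - near: d; exact: nbhs_right_lt.
  - near: d; exact: h.
exists d => // x y xy; have [xr|xr] := leP `|x| (`|r| + 1); first exact: hd xy.
have rr := ler_norm r.
have yr : `|r| < `|y|.
  have : `|x| <= `|x - y| + `|y| by rewrite -{1}(subrK y x); exact: ler_normD.
  lra.
rewrite !f0 ?subrr ?normr0//; first exact: le_lt_trans yr.
by apply: le_lt_trans xr; lra.
Unshelve. all: end_near. Qed.

End Cinfty_theory.

(** * Convolution *)

Section convolution.
Context {R : realType} {N : nat}.
Implicit Types f g k : 'rV[R]_N -> R.
Local Notation mu := (@lebesgueN R N).
Local Notation delta i := (delta_mx ord0 i : 'rV[R]_N).

Lemma measurable_norm_le (M : R) : measurable [set x : 'rV[R]_N | `|x| <= M].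
Proof.
rewrite -[X in measurable X]setCK; apply: measurableC; apply: measurable_open_rV.
rewrite openC; exact: closed_norm_le.
Qed.

Lemma bounded_integrable D f M L : measurable D -> measurable_fun D f ->
  (forall x, D x -> `|f x| <= M) -> (forall x, D x -> L < `|x| -> f x = 0) ->
  mu.-integrable D (EFin \o f).
Proof.
move=> mD mf fM f0.
have mB := measurable_norm_le L.
set B := [set x : 'rV[R]_N | `|x| <= L] in mB *.
have iB : mu.-integrable D ((cst (`|M|)%:E) \_ B).
  apply: (integrableS measurableT) => //; apply/(integrable_mkcond _ mB).
  apply/integrableP; split; first exact: measurable_cst.
  rewrite (eq_integral (cst `|M|%:E)); last by move=> x _ /=; rewrite normr_id.
  by rewrite integral_cst// lte_mul_pinfty//; exact: lebesgueN_ball_lty.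
apply: (le_integrable mD _ _ iB); first exact/measurable_EFinP.
move=> x Dx /=; rewrite patchE; case: ifPn => hx.
  by rewrite lee_fin normr_id; apply: le_trans (fM x Dx) (ler_norm _).
rewrite f0 ?normr0 ?abse0//; move: hx; rewrite notin_setE/= => /negP.
by rewrite -ltNge.
Qed.

Lemma bounded_integrableT f M L : measurable_fun setT f ->
  (forall x, `|f x| <= M) -> (forall x, L < `|x| -> f x = 0) ->
  mu.-integrable setT (EFin \o f).
Proof. by move=> mf fM f0; apply: (@bounded_integrable setT f M L) => // x _; exact: f0. Qed.

Definition conv f k : 'rV[R]_N -> R := fun x => \int[mu]_y (f y * k (x - y)).

Definition bounded_csupp f := [/\ measurable_fun setT f, exists M, forall x, `|f x| <= M &
  exists L, forall x, L < `|x| -> f x = 0].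

Lemma bounded_csupp_integrable f : bounded_csupp f -> mu.-integrable setT (EFin \o f).
Proof. by move=> [mf [M fM] [L f0]]; exact: bounded_integrableT mf fM f0. Qed.

Lemma bounded_csuppM f g : bounded_csupp f -> measurable_fun setT g -> (exists M, forall x, `|g x| <= M) ->
  bounded_csupp (fun x => f x * g x).
Proof.
move=> [mf [M fM] [L f0]] mg [K gK]; split.
- exact: measurable_funM.
- by exists (M * K) => x; rewrite normrM ler_pM.
- by exists L => x Lx; rewrite f0// mul0r.
Qed.

Lemma bounded_csuppB f g : bounded_csupp f -> bounded_csupp g -> bounded_csupp (fun x => f x - g x).
Proof.
move=> [mf [M fM] [L f0]] [mg [K gK] [L' g0]]; split.
- exact: measurable_funB.
- by exists (M + K) => x; apply: le_trans (ler_normB _ _) _; exact: lerD.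
- exists (Num.max L L') => x; rewrite gt_max => /andP[h1 h2].
  by rewrite f0// g0// subr0.
Qed.

Lemma bounded_csupp_norm f : bounded_csupp f -> bounded_csupp (fun x => `|f x|).
Proof.
move=> [mf [M fM] [L f0]]; split.
- exact: measurableT_comp.
- by exists M => x; rewrite normr_id.
- by exists L => x Lx; rewrite f0// normr0.
Qed.

Definition continuous_csupp k := continuous k /\ exists L, forall x, L < `|x| -> k x = 0.

Lemma continuous_csupp_bounded k : continuous_csupp k -> exists M, forall x, `|k x| <= M.
Proof. by move=> [ck [L k0]]; have [C _ hC] := compact_support_bounded ck k0; exists C. Qed.

Lemma continuous_csupp_bounded_csupp k : continuous_csupp k -> bounded_csupp k.
Proof.
move=> kc; split; [|exact: continuous_csupp_bounded|by case: kc].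
by apply: measurable_fun_continuous_rV; case: kc.
Qed.

Lemma continuous_reflect k x : continuous k -> continuous (fun y : 'rV[R]_N => k (x - y)).
Proof.
move=> ck; have c : continuous (k \o (fun y => x - y)).
  move=> y; apply: continuous_comp; last exact: ck.
  by apply: continuousB; [exact: cst_continuous|exact: cvg_id].
exact: c.
Qed.

Lemma continuous_csupp_reflect k x : continuous_csupp k -> continuous_csupp (fun y => k (x - y)).
Proof.
move=> [ck [L k0]]; split; first exact: continuous_reflect.
exists (L + `|x|) => y h; apply: k0.
have := ler_normB x (x - y); rewrite opprB addrC subrK => h'.
by move: h; rewrite -ltrBrDr => /lt_le_trans; apply; lra.
Qed.

Lemma bounded_csupp_conv_integrand f k x : bounded_csupp f -> continuous_csupp k -> bounded_csupp (fun y => f y * k (x - y)).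
Proof.
move=> bf kc; apply: bounded_csuppM => //; last exact/continuous_csupp_bounded/continuous_csupp_reflect.
by have [ck _] := continuous_csupp_reflect x kc; exact: measurable_fun_continuous_rV ck.
Qed.

Lemma conv_integrable f k x : bounded_csupp f -> continuous_csupp k ->
  mu.-integrable setT (EFin \o (fun y => f y * k (x - y))).
Proof. by move=> bf kc; apply: bounded_csupp_integrable; exact: bounded_csupp_conv_integrand. Qed.

Lemma conv_continuous f k : bounded_csupp f -> continuous_csupp k -> continuous (conv f k).
Proof.
move=> bf kc x.
have iF := bounded_csupp_integrable (bounded_csupp_norm bf).
pose I := \int[mu]_y `|f y|.
have I0 : 0 <= I by apply: Rintegral_ge0.
apply/(@cvgrPdist_le _ _ _ (nbhs x) _ (conv f k) (conv f k x)) => e e0.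
(* [I] is the L^1 norm of [f]; adding 1 covers the case [I = 0]. *)
have e1 : 0 < e / (I + 1) by rewrite divr_gt0// ltr_wpDl.
have [ck [L k0]] := kc.
have [d d0 hd] := compact_support_unif ck k0 e1.
near=> z.
rewrite /conv -RintegralB//; try exact: conv_integrable.
apply: le_trans (le_normr_Rintegral _ _) _ => //.
  by apply: bounded_csupp_integrable; apply: bounded_csuppB; exact: bounded_csupp_conv_integrand.
apply: (@le_trans _ _ (\int[mu]_y (`|f y| * (e / (I + 1))))).
  apply: le_Rintegral => //.
  - by apply: bounded_csupp_integrable; apply: bounded_csupp_norm; apply: bounded_csuppB; exact: bounded_csupp_conv_integrand.
  - apply: (@bounded_csupp_integrable (fun y => `|f y| * (e / (I + 1)))); apply: bounded_csuppM => //.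
      exact: bounded_csupp_norm.
    by exists (`|e / (I + 1)|).
  - move=> y _; rewrite -mulrBr normrM ler_wpM2l// ltW// hd// opprB addrA subrK.
    near: z; apply/nbhs_ballP; exists d => // z; by rewrite mx_norm_ball.
rewrite RintegralZr// -/I mulrCA ler_piMr ?(ltW e0)// ler_pdivrMr ?mul1r ?lerDl// ltr_wpDl//.
Unshelve. all: end_near. Qed.

(** Differentiation under the integral sign along the line [x + t e_i], dominated by [M |f|] with
    [M] a bound of the partial derivative of the kernel. Only the kernel is differentiated, so [f]
    needs no regularity beyond measurability. *)
Lemma conv_partial f k i x : bounded_csupp f -> continuous_csupp k -> Cn 1 k ->
  is_derive x (delta i) (conv f k) (conv f (partial i k) x).
Proof.
move=> bf kc k1.
have [ck [L k0]] := kc.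
have kc' : continuous_csupp (partial i k).
  split; first exact: Cn_continuous (Cn_partial i k1).
  by exists L; exact: partial_eq0.
have [M kM] := continuous_csupp_bounded kc'.
apply/is_derive_line.
pose F (t : R) (y : 'rV[R]_N) := f y * k (t *: delta i + x - y).
pose I : set R := `]-1, 1[%classic.
have I0 : I 0 by rewrite /I /= in_itv/=; lra.
have dF (t : R) (y : 'rV[R]_N) :
    is_derive t 1 (F ^~ y) (f y * partial i k (t *: delta i + x - y)).
  have /is_derive_line := Cn_is_derive i (t *: delta i + x - y) k1.
  set d := partial _ _ _ => h.
  have h' : is_derive (- t + 1 * t) 1 (fun s : R => k (s *: delta i + (t *: delta i + x - y))) d.
    by rewrite mul1r addNr.
  have := is_deriveZ (f y) (is_derive_affine h'); rewrite mul1r.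
  rewrite (_ : (f y \*: _) = F ^~ y)//.
  apply/funext => s; rewrite /F /=; congr (_ * k _).
  by rewrite mul1r scalerDl scaleNr -[X in _ + X = _]addrA addrACA addNr add0r addrA.
have iF : forall t : R, I t -> mu.-integrable setT (EFin \o F t).
  by move=> t _; exact: conv_integrable.
have dF1 : forall (t : R) (y : 'rV[R]_N), I t -> setT y -> derivable (F ^~ y) t 1.
  by move=> t y _ _; have [] := dF t y.
have G0 : forall y, 0 <= M * `|f y|.
  by move=> y; rewrite mulr_ge0//; apply: le_trans (kM 0).
have iG : mu.-integrable setT (EFin \o (fun y => M * `|f y|)).
  rewrite (_ : (fun y => _) = (fun y => `|f y| * M)); last first.
    by apply/funext => y; rewrite mulrC.
  apply: bounded_csupp_integrable; apply: bounded_csuppM => //; first exact: bounded_csupp_norm.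
  by exists `|M|.
have GF : forall (t : R) (y : 'rV[R]_N), I t -> setT y -> `|partial1of2 F t y| <= M * `|f y|.
  move=> t y _ _; rewrite partial1of2E; have [_ ->] := dF t y.
  by rewrite normrM mulrC ler_wpM2r.
have dd := @derivable_under_integral _ _ _ mu F setT measurableT 0 (-1) 1 I0 iF dF1 _ G0 iG GF.
have dE := @differentiation_under_integral _ _ _ mu F setT measurableT 0 (-1) 1 I0 iF dF1 _ G0 iG GF.
apply: DeriveDef; first exact: dd.
rewrite -derive1E; rewrite /conv.
transitivity (\int[mu]_y (partial1of2 F ^~ y) 0); first exact: dE.
apply: eq_Rintegral => y _; rewrite partial1of2E; have [_ ->] := dF 0 y.
by rewrite scale0r add0r.
Qed.

Lemma conv_Cn n f k : bounded_csupp f -> continuous_csupp k -> Cn n k -> Cn n (conv f k).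
Proof.
elim: n k => [|n IH] k bf kc ck; first by split => //; exact: conv_continuous.
have k1 : Cn 1 k by elim: n ck {IH} => // n IHn ck; apply: IHn; exact: CnW.
apply: (@CnS _ _ _ _ (fun i => conv f (partial i k))).
- exact: conv_continuous.
- by move=> i x; exact: conv_partial.
- move=> i; apply: IH => //; last exact: Cn_partial.
  case: kc => _ [L k0]; split; first exact: Cn_continuous (Cn_partial i k1).
  by exists L; exact: partial_eq0.
Qed.

Lemma continuous_csupp_mol r : 0 < r -> continuous_csupp (@mol R N r).
Proof.
move=> r0; split; first exact: continuous_mol.
by exists r => x /ltW; exact: mol_eq0.
Qed.

Lemma Cinfty_conv_mol f r : 0 < r -> bounded_csupp f -> Cinfty (conv f (mol r)).
Proof. by move=> r0 bf n; apply: conv_Cn => //; [exact: continuous_csupp_mol|exact: Cinfty_mol]. Qed.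

Lemma mol_integrable r x : 0 < r -> mu.-integrable setT (EFin \o (fun y => @mol R N r (x - y))).
Proof. by move=> r0; apply: bounded_csupp_integrable; apply: continuous_csupp_bounded_csupp; apply: continuous_csupp_reflect; exact: continuous_csupp_mol. Qed.

Lemma mol_Rintegral r (x : 'rV[R]_N) : 0 < r -> \int[mu]_y mol r (x - y) = 1.
Proof. by move=> r0; rewrite /Rintegral mol_integralr. Qed.

(** [mol r] is a probability density that vanishes outside the ball of radius [r], so the
    convolution at [x] is an average of the values of [f] at distance less than [r] from [x]. *)
Lemma conv_mol_le f r x C : 0 < r -> bounded_csupp f -> (forall y, `|x - y| < r -> f y <= C) ->
  conv f (mol r) x <= C.
Proof.
move=> r0 bf fC; rewrite -[leRHS]mulr1 -(mol_Rintegral x r0) -RintegralZl//; last exact: mol_integrable.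
apply: le_Rintegral => //.
- by apply: conv_integrable => //; exact: continuous_csupp_mol.
- rewrite (_ : EFin \o _ = (fun y => C%:E * (mol r (x - y))%:E)%E)//.
  apply: integrableZl => //; exact: mol_integrable.
- move=> y _; have [xy|xy] := ltP `|x - y| r; first by rewrite ler_wpM2r ?mol_ge0// fC.
  by rewrite mol_eq0// !mulr0.
Qed.

Lemma conv_mol_ge f r x C : 0 < r -> bounded_csupp f -> (forall y, `|x - y| < r -> C <= f y) ->
  C <= conv f (mol r) x.
Proof.
move=> r0 bf fC; rewrite -[leLHS]mulr1 -(mol_Rintegral x r0) -RintegralZl//; last exact: mol_integrable.
apply: le_Rintegral => //.
- rewrite (_ : EFin \o _ = (fun y => C%:E * (mol r (x - y))%:E)%E)//.
  apply: integrableZl => //; exact: mol_integrable.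
- by apply: conv_integrable => //; exact: continuous_csupp_mol.
- move=> y _; have [xy|xy] := ltP `|x - y| r; first by rewrite ler_wpM2r ?mol_ge0// fC.
  by rewrite mol_eq0// !mulr0.
Qed.

Lemma conv_mol_dist f r x e : 0 < r -> bounded_csupp f -> (forall y, `|x - y| < r -> `|f x - f y| <= e) ->
  `|conv f (mol r) x - f x| <= e.
Proof.
move=> r0 bf fe; rewrite ler_distl; apply/andP; split.
  by apply: conv_mol_ge => // y /fe; rewrite ler_distl => /andP[]; lra.
by apply: conv_mol_le => // y /fe; rewrite ler_distl => /andP[]; lra.
Qed.

End convolution.

(** * Density of continuous functions in L^1 and mollification *)

Section density.
Import HBSimple.
Context {R : realType} {N : nat}.
Implicit Types f g k : 'rV[R]_N -> R.
Local Notation mu := (@lebesgueN R N).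

Section fixed_ball.
Variable L : R.
Let B := [set x : 'rV[R]_N | `|x| <= L].

Lemma ball_integrable f M : measurable_fun setT f -> (forall x, `|f x| <= M) ->
  mu.-integrable B (EFin \o f).
Proof.
move=> mf fM; apply: (@bounded_integrable _ _ _ _ M L).
- exact: measurable_norm_le.
- exact: measurable_funTS.
- by move=> x _; exact: fM.
- by move=> x /= xL; rewrite ltNge xL.
Qed.

Lemma ball_dominated (f_ : nat -> 'rV[R]_N -> R) f :
  (forall n, measurable_fun setT (f_ n)) -> measurable_fun setT f ->
  (forall n x, `|f_ n x| <= 1) -> (forall x, f_ n x @[n --> \oo] --> f x) ->
  forall e, 0 < e -> exists n, \int[mu]_(x in B) `|f x - f_ n x| <= e.
Proof.
move=> mf_ mf f1 cf e e0.
have mB : measurable B by exact: measurable_norm_le.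
have i1 : mu.-integrable B (EFin \o cst 1).
  by apply: (@ball_integrable (cst 1) 1) => // x; rewrite /= normr1.
have H1 n : measurable_fun B (fun x => (f_ n x)%:E).
  by apply/measurable_EFinP; exact: measurable_funTS.
have H2 : measurable_fun B (EFin \o f).
  by apply/measurable_EFinP; exact: measurable_funTS.
have H3 : {ae mu, forall x, B x -> (f_ n x)%:E @[n --> \oo] --> (EFin \o f) x}.
  by apply: aeW => x Bx; apply: cvg_EFin; [exact: nearW|exact: cf].
have H4 : {ae mu, forall x n, B x -> (`|(f_ n x)%:E| <= (1%R)%:E)%E}.
  by apply: aeW => x n Bx; rewrite lee_fin.
have [_ h _] := dominated_convergence mB H1 H2 H3 i1 H4.
have {}h : \int[mu]_(x in B) `|f_ n x - f x| @[n --> \oo] --> 0.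
  exact/fine_cvg.
have /cvgrPdist_le/(_ _ e0)[n _ /(_ n (leqnn n))] := h.
rewrite sub0r normrN ger0_norm; last exact: Rintegral_ge0.
move=> hn; exists n; apply: le_trans hn.
rewrite le_eqVlt; apply/orP; left; apply/eqP.
by apply: eq_Rintegral => x _; rewrite distrC.
Qed.

(* These sets form a sigma-algebra containing the coordinate half-spaces, hence
   they are all the measurable sets. *)
Definition approx_set (A : set 'rV[R]_N) := measurable A /\ forall e, 0 < e ->
  exists c : 'rV[R]_N -> R, [/\ continuous c, forall x, 0 <= c x <= 1 &
    \int[mu]_(x in B) `|\1_A x - c x| <= e].

(** Dominated convergence replaces the indicator of [A] by some [f_ n], which is in turn replaced by
    a continuous function, each time at the cost [e / 2]. It serves for countable unions and for
    half-spaces. *)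
Lemma approx_set_cvg (f_ : nat -> 'rV[R]_N -> R) A : measurable A ->
  (forall n, measurable_fun setT (f_ n)) -> (forall n x, 0 <= f_ n x <= 1) ->
  (forall x, f_ n x @[n --> \oo] --> (\1_A x : R)) ->
  (forall n e, 0 < e -> exists c : 'rV[R]_N -> R, [/\ continuous c, forall x, 0 <= c x <= 1 &
    \int[mu]_(x in B) `|f_ n x - c x| <= e]) -> approx_set A.
Proof.
move=> mA mf_ f01 cf af; split => // e e0.
have e20 : 0 < e / 2 by rewrite divr_gt0.
have m1 : measurable_fun setT (\1_A : 'rV[R]_N -> R) by exact: measurable_indic.
have f1 n x : `|f_ n x| <= 1 by have /andP[? ?] := f01 n x; rewrite ger0_norm.
have [n hn] := ball_dominated mf_ m1 f1 cf e20.
have [c [cc c01 hc]] := af n _ e20.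
exists c; split => //.
have mc := measurable_fun_continuous_rV cc.
have mB : measurable B by exact: measurable_norm_le.
have I2 (g h : 'rV[R]_N -> R) : measurable_fun setT g -> measurable_fun setT h ->
  (forall x, 0 <= g x <= 1) -> (forall x, 0 <= h x <= 1) -> mu.-integrable B (EFin \o (fun x => `|g x - h x|)).
  move=> mg mh g01 h01; apply: (@ball_integrable _ 1).
    by apply: measurableT_comp => //; exact: measurable_funB.
  move=> x; rewrite normr_id ler_norml; have := g01 x; have := h01 x; lra.
have i01 x : 0 <= (\1_A x : R) <= 1 by rewrite indicE; case: (_ \in _); rewrite /= ?ler01 ?lexx.
apply: (@le_trans _ _ (\int[mu]_(x in B) (`|\1_A x - f_ n x| + `|f_ n x - c x|))).
  apply: le_Rintegral => //; first exact: I2.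
    have := integrableD mB (I2 _ _ m1 (mf_ n) i01 (f01 n)) (I2 _ _ (mf_ n) mc (f01 n) c01).
    by [].
  move=> x _; rewrite -(subrKA (f_ n x)); exact: ler_normD.
by rewrite RintegralD//; [lra|exact: I2|exact: I2].
Qed.

Lemma approx_set0 : approx_set set0.
Proof.
split => // e e0; exists (cst 0); split; [exact: cst_continuous|by move=> x; rewrite lexx ler01|].
rewrite (_ : (fun x => _) = cst 0) ?Rintegral_cst ?mul0r ?(ltW e0)//; first exact: measurable_norm_le.
by apply/funext => x; rewrite indic0 subrr normr0.
Qed.

Lemma approx_setC A : approx_set A -> approx_set (~` A).
Proof.
move=> [mA hA]; split; first exact: measurableC.
move=> e /hA[c [cc c01 hc]]; exists (fun x => 1 - c x); split.
- by move=> x; apply: continuousB; [exact: cst_continuous|exact: cc].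
- by move=> x; have := c01 x; lra.
- apply: le_trans hc; rewrite le_eqVlt; apply/orP; left; apply/eqP.
  apply: eq_Rintegral => x _; rewrite !indicE in_setC -normrN.
  by case: (_ \in _) => /=; congr (`| _ |); ring.
Qed.

(** The product of the two approximants works: in 1_A 1_A' - c d = (1_A - c) 1_A' + c (1_A' - d) the
    outer factors are at most 1 in absolute value. *)
Lemma approx_setI A A' : approx_set A -> approx_set A' -> approx_set (A `&` A').
Proof.
move=> [mA hA] [mA' hA']; split; first exact: measurableI.
move=> e e0; have e20 : 0 < e / 2 by rewrite divr_gt0.
have [c [cc c01 hc]] := hA _ e20; have [d [cd d01 hd]] := hA' _ e20.
have cM : continuous (fun x => c x * d x) by move=> x; apply: continuousM; [exact: cc|exact: cd].
exists (fun x => c x * d x); split => //.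
- move=> x; have := c01 x; have := d01 x => /andP[? ?] /andP[? ?].
  by rewrite mulr_ge0//= mulr_ile1.
have mc := measurable_fun_continuous_rV cc.
have md := measurable_fun_continuous_rV cd.
have mcd := measurable_fun_continuous_rV cM.
have mB : measurable B by exact: measurable_norm_le.
have I2 (A1 : set 'rV[R]_N) (h : 'rV[R]_N -> R) : measurable A1 -> measurable_fun setT h ->
  (forall x, 0 <= h x <= 1) -> mu.-integrable B (EFin \o (fun x => `|\1_A1 x - h x|)).
  move=> mg mh h01; apply: (@ball_integrable _ 1).
    by apply: measurableT_comp => //; apply: measurable_funB => //; exact: measurable_indic.
  move=> x; rewrite normr_id ler_norml indicE; have := h01 x; case: (_ \in _); rewrite /=; lra.
apply: (@le_trans _ _ (\int[mu]_(x in B) (`|\1_A x - c x| + `|\1_A' x - d x|))).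
  apply: le_Rintegral => //.
  - apply: I2 => //; first exact: measurableI.
    move=> x; have := c01 x; have := d01 x => /andP[? ?] /andP[? ?].
    by rewrite mulr_ge0//= mulr_ile1.
  - have := integrableD mB (I2 _ _ mA mc c01) (I2 _ _ mA' md d01).
    by [].
  - move=> x _; rewrite indicI /=.
    have -> : \1_A x * \1_A' x - c x * d x = (\1_A x - c x) * \1_A' x + c x * (\1_A' x - d x) by ring.
    apply: le_trans (ler_normD _ _) _; rewrite !normrM; apply: lerD.
      rewrite ler_piMr// indicE; by case: (_ \in _); rewrite /= ?normr1 ?normr0 ?ler01.
    rewrite ler_piMl//; have /andP[? ?] := c01 x; by rewrite ger0_norm.
by rewrite RintegralD//; [lra|exact: I2|exact: I2].
Qed.

Lemma approx_set_bigcup (F : (set 'rV[R]_N)^nat) :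
  (forall i, approx_set (F i)) -> approx_set (\bigcup_i F i).
Proof.
move=> aF.
(* Finite unions come from intersections and complements; the countable union is then the pointwise
   limit of their indicators. *)
have aU n : approx_set (\big[setU/set0]_(i < n) F i).
  elim: n => [|n IH]; first by rewrite big_ord0; exact: approx_set0.
  rewrite big_ord_recr /= -[X in approx_set X]setCK setCU.
  by apply: approx_setC; apply: approx_setI; exact: approx_setC.
apply: (@approx_set_cvg (fun n => \1_(\big[setU/set0]_(i < n) F i))).
- by apply: bigcup_measurable => i _; case: (aF i).
- by move=> n; apply: measurable_indic; case: (aU n).
- by move=> n x; rewrite indicE; case: (_ \in _); rewrite /= ?ler01 ?lexx.
- move=> x; rewrite [X in _ --> X]indicE.
  have [/set_mem[m _ Fx]|nx] := boolP (x \in \bigcup_i F i).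
    apply: cvg_near_cst; near=> n; rewrite indicE mem_set//.
    rewrite -bigcup_mkord; exists m => //=; near: n; exact: nbhs_infty_gt.
  apply: cvg_near_cst; apply: nearW => n; rewrite indicE memNset// => h.
  move/negP: nx; apply; rewrite inE; move: h; rewrite -bigcup_mkord => -[m _ Fx]; by exists m.
- by move=> n; case: (aU n).
Unshelve. all: end_near. Qed.

Lemma approx_set_sigma : sigma_algebra setT approx_set.
Proof.
split; [exact: approx_set0| |exact: approx_set_bigcup].
by move=> A aA; rewrite setTD; exact: approx_setC.
Qed.

(** The indicator is the pointwise limit of the ramps obtained by truncating [n (x_i - a)] to
    [0, 1]. *)
Lemma approx_set_ray i (a : R) : approx_set [set x | a < x ord0 i].
Proof.
have cx : continuous (fun x : 'rV[R]_N => x ord0 i) by exact: coord_continuous.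
pose c (n : nat) (x : 'rV[R]_N) : R := Num.max 0 (Num.min 1 (n%:R * (x ord0 i - a))).
have cc n : continuous (c n).
  have c1 : continuous (fun x : 'rV[R]_N => n%:R * (x ord0 i - a)).
    have c0 : continuous (fun x : 'rV[R]_N => x ord0 i - a).
      by move=> x; apply: continuousB; [exact: cx|exact: cst_continuous].
    have cq (q : R) : continuous (fun x : 'rV[R]_N => q * (x ord0 i - a)).
      by move=> x; exact: (continuousM (@cst_continuous _ _ q x) (c0 x)).
    exact: cq.
  have c2 : continuous ((cst 1 : 'rV[R]_N -> R) \min (fun x => n%:R * (x ord0 i - a))).
    by apply: min_fun_continuous => //; exact: cst_continuous.
  have c3 : continuous ((cst 0 : 'rV[R]_N -> R) \max ((cst 1 : 'rV[R]_N -> R) \min (fun x => n%:R * (x ord0 i - a)))).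
    by apply: max_fun_continuous => //; exact: cst_continuous.
  exact: c3.
have c01 n x : 0 <= c n x <= 1.
  by rewrite /c le_max lexx /= ge_max ler01 ge_min lexx.
apply: (@approx_set_cvg c) => //.
- apply: measurable_open_rV.
  have -> : (fun x => [set x : 'rV[R]_N | a < x ord0 i] x) = (fun x : 'rV[R]_N => x ord0 i) @^-1` [set t | a < t] by [].
  by apply: open_comp; [move=> x _; exact: cx|exact: open_gt].
- by move=> n; exact: measurable_fun_continuous_rV.
- move=> x; rewrite indicE; have [xa|xa] := ltP a (x ord0 i).
    rewrite mem_set//; apply: cvg_near_cst; near=> n.
    have h : 1 <= n%:R * (x ord0 i - a).
      rewrite -ler_pdivrMr ?subr_gt0//; near: n; exact: nbhs_infty_ger.
    by rewrite /c min_l// max_r.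
  rewrite memNset; last by rewrite /= ltNge xa.
  apply: cvg_near_cst; apply: nearW => n; rewrite /c max_l//.
  by rewrite ge_min; apply/orP; right; rewrite mulr_ge0_le0// subr_le0.
- move=> n e e0; exists (c n); split => //.
  rewrite (_ : (fun x => _) = cst 0) ?Rintegral_cst ?mul0r ?(ltW e0)//; first exact: measurable_norm_le.
  by apply/funext => x; rewrite subrr normr0.
Unshelve. all: end_near. Qed.

(** Two nested generation arguments: the sigma-algebra is generated by the preimages of Borel sets
    under the coordinates, and the Borel sets of the line are generated by open rays. *)
Lemma approx_setP A : measurable A -> approx_set A.
Proof.
apply: smallest_sub; first exact: approx_set_sigma.
rewrite -bigcup_seq; apply: bigcup_sub => i _ _ [Y mY <-]; rewrite setTI.
have : (RGenOInfty.G (R:=R)).-sigma.-measurable Y by rewrite -RGenOInfty.measurableE.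
clear mY; move: Y; apply: (@smallest_sub _ _ _ (fun Y => approx_set ((fun x : 'rV[R]_N => x ord0 i) @^-1` Y))).
  split.
  - by rewrite /= preimage_set0; exact: approx_set0.
  - by move=> Y /= hY; rewrite setTD preimage_setC; exact: approx_setC.
  - by move=> F hF /=; rewrite preimage_bigcup; exact: approx_set_bigcup.
move=> _ [a ->] /=; rewrite (_ : _ @^-1` _ = [set x : 'rV[R]_N | a < x ord0 i]); first exact: approx_set_ray.
by apply/seteqP; split => x /=; rewrite in_itv/= andbT.
Qed.


Definition approx_fun f := [/\ measurable_fun setT f, exists M, forall x, `|f x| <= M &
  forall e, 0 < e -> exists c : 'rV[R]_N -> R, [/\ continuous c, exists M, forall x, `|c x| <= M &
    \int[mu]_(x in B) `|f x - c x| <= e]].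

Lemma ball_integrableB f g : measurable_fun setT f -> (exists M, forall x, `|f x| <= M) ->
  measurable_fun setT g -> (exists M, forall x, `|g x| <= M) ->
  mu.-integrable B (EFin \o (fun x => `|f x - g x|)).
Proof.
move=> mf [M fM] mg [K gK]; apply: (@ball_integrable _ (M + K)).
  by apply: measurableT_comp => //; exact: measurable_funB.
by move=> x; rewrite normr_id; apply: le_trans (ler_normB _ _) _; exact: lerD.
Qed.

Lemma approx_funD f g : approx_fun f -> approx_fun g -> approx_fun (fun x => f x + g x).
Proof.
move=> [mf bf hf] [mg bg hg]; have [M fM] := bf; have [K gK] := bg; split.
- exact: measurable_funD.
- by exists (M + K) => x; apply: le_trans (ler_normD _ _) _; exact: lerD.
- move=> e e0; have e20 : 0 < e / 2 by rewrite divr_gt0.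
  have [c [cc bc hc]] := hf _ e20; have [d [cd bd hd]] := hg _ e20.
  have [C cC] := bc; have [D dD] := bd.
  have mB : measurable B by exact: measurable_norm_le.
  have mc := measurable_fun_continuous_rV cc.
  have md := measurable_fun_continuous_rV cd.
  have ccd : continuous (fun x => c x + d x) by move=> x; apply: continuousD; [exact: cc|exact: cd].
  exists (fun x => c x + d x); split => //.
    by exists (C + D) => x; apply: le_trans (ler_normD _ _) _; exact: lerD.
  apply: (@le_trans _ _ (\int[mu]_(x in B) (`|f x - c x| + `|g x - d x|))).
    apply: le_Rintegral => //.
    + apply: ball_integrableB; [exact: measurable_funD| |exact: measurable_funD|].
        by exists (M + K) => x; apply: le_trans (ler_normD _ _) _; exact: lerD.
      by exists (C + D) => x; apply: le_trans (ler_normD _ _) _; exact: lerD.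
    + have := integrableD mB (ball_integrableB mf bf mc bc) (ball_integrableB mg bg md bd).
      by [].
    + move=> x _; have -> : f x + g x - (c x + d x) = (f x - c x) + (g x - d x) by ring.
      exact: ler_normD.
  by rewrite RintegralD//; [lra|exact: ball_integrableB|exact: ball_integrableB].
Qed.

Lemma approx_fun_indic A (a : R) : measurable A -> approx_fun (fun x => a * \1_A x).
Proof.
move=> mA; have [_ hA] := approx_setP mA.
have m1 : measurable_fun setT (\1_A : 'rV[R]_N -> R) by exact: measurable_indic.
have b1 : exists M, forall x, `|\1_A x : R| <= M.
  by exists 1 => x; rewrite indicE; case: (_ \in _); rewrite /= ?normr1 ?normr0.
split.
- exact: measurable_funM.
- have [M hM] := b1; exists (`|a| * M) => x; by rewrite normrM ler_wpM2l.
- move=> e e0; have e1 : 0 < e / (`|a| + 1) by rewrite divr_gt0// ltr_wpDl.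
  have [c [cc c01 hc]] := hA _ e1.
  have bc : exists M, forall x, `|c x| <= M.
    by exists 1 => x; have /andP[? ?] := c01 x; rewrite ger0_norm.
  have mc := measurable_fun_continuous_rV cc.
  have mB : measurable B by exact: measurable_norm_le.
  exists (fun x => a * c x); split.
  + move=> x; exact: (continuousM (@cst_continuous _ _ a x) (cc x)).
  + have [M hM] := bc; exists (`|a| * M) => x; by rewrite normrM ler_wpM2l.
  + under eq_Rintegral do rewrite -mulrBr normrM.
    rewrite RintegralZl//; last exact: ball_integrableB.
    apply: le_trans (ler_wpM2l (normr_ge0 a) hc) _.
    rewrite mulrCA ler_piMr ?(ltW e0)// ler_pdivrMr ?mul1r ?lerDl// ltr_wpDl//.
Qed.

Lemma approx_fun_sfun (f : {sfun 'rV[R]_N >-> R}) : approx_fun f.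
Proof.
rewrite (_ : (f : _ -> _) = (fun x => \sum_(y \in range f) y * \1_(f @^-1` [set y]) x)); last first.
  by apply/funext => x; rewrite {1}fimfunE.
rewrite (_ : (fun x => _) = (fun x => \sum_(y <- finmap.enum_fset (fset_set (range f))) y * \1_(f @^-1` [set y]) x)); last first.
  by apply/funext => x; rewrite fsbig_finite//=; exact: fimfunP.
elim: (finmap.enum_fset _) => [|y s IH].
  rewrite (_ : (fun x => _) = (fun x => 0 * \1_(set0 : set 'rV[R]_N) x)).
    exact: approx_fun_indic.
  by apply/funext => x; rewrite big_nil mul0r.
rewrite (_ : (fun x => _) = (fun x => y * \1_(f @^-1` [set y]) x + \sum_(z <- s) z * \1_(f @^-1` [set z]) x)).
  by apply: approx_funD => //; exact: approx_fun_indic.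
by apply/funext => x; rewrite big_cons.
Qed.

End fixed_ball.
(** On a ball that contains the support, [f] is approximated by a simple function and the latter by
    a bounded continuous one; a cut-off then makes the approximant compactly supported. *)
Lemma dense_continuous_csupp f : bounded_csupp f -> forall e, 0 < e ->
  exists c, continuous_csupp c /\ \int[mu]_x `|f x - c x| <= e.
Proof.
move=> bf e e0; have [mf fb [L0 f0]] := bf.
pose L := `|L0| + 1; pose B := [set x : 'rV[R]_N | `|x| <= L].
have mB : measurable B by exact: measurable_norm_le.
have e20 : 0 < e / 2 by rewrite divr_gt0.
have iB : mu.-integrable B (EFin \o f).
  by apply: (integrableS measurableT) => //; exact: bounded_csupp_integrable.
have [g_ [ig _ hg]] := approximation_sfun_integrable mB iB.
have {}hg : \int[mu]_(x in B) `|f x - g_ n x| @[n --> \oo] --> 0.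
  exact/fine_cvg.
have /cvgrPdist_le/(_ _ e20)[n _ /(_ n (leqnn n))] := hg.
rewrite sub0r normrN ger0_norm; last exact: Rintegral_ge0.
move=> {}hg.
have [mg gb ag] := approx_fun_sfun L (g_ n).
have [c [cc cb hc]] := ag _ e20.
have mc := measurable_fun_continuous_rV cc.
have hfc : \int[mu]_(x in B) `|f x - c x| <= e.
  apply: (@le_trans _ _ (\int[mu]_(x in B) (`|f x - g_ n x| + `|g_ n x - c x|))).
    apply: le_Rintegral => //; first exact: ball_integrableB.
      have := integrableD mB (ball_integrableB L mf fb mg gb) (ball_integrableB L mg gb mc cb).
      by [].
    move=> x _; rewrite -(subrKA (g_ n x)); exact: ler_normD.
  by rewrite RintegralD//; [lra|exact: ball_integrableB|exact: ball_integrableB].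
(* A continuous cut-off with values in [0, 1], equal to 1 on [|x| <= L0] and to 0 beyond [L]. As
   [f = f chi], multiplying the approximant by [chi] does not increase the error. *)
pose chi (x : 'rV[R]_N) : R := Num.max 0 (Num.min 1 (L - `|x|)).
have cchi : continuous chi.
  have c1 (q : R) : continuous (fun x : 'rV[R]_N => q - `|x|).
    by move=> x; apply: continuousB; [exact: cst_continuous|exact: norm_continuous].
  have c2 : continuous ((cst 1 : 'rV[R]_N -> R) \min (fun x => L - `|x|)).
    by apply: min_fun_continuous => //; exact: cst_continuous.
  have c3 : continuous ((cst 0 : 'rV[R]_N -> R) \max ((cst 1 : 'rV[R]_N -> R) \min (fun x => L - `|x|))).
    by apply: max_fun_continuous => //; exact: cst_continuous.
  exact: c3.
have chi01 x : 0 <= chi x <= 1.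
  by rewrite /chi le_max lexx /= ge_max ler01 ge_min lexx.
have chi0 x : L < `|x| -> chi x = 0.
  move=> h; rewrite /chi max_l// ge_min; apply/orP; right; lra.
have chi1 x : `|x| <= L0 -> chi x = 1.
  move=> h; rewrite /chi min_l ?max_r// /L; have := ler_norm L0; lra.
have kc : continuous_csupp (fun x => c x * chi x).
  split; first by move=> x; apply: continuousM; [exact: cc|exact: cchi].
  by exists L => x /chi0 ->; rewrite mulr0.
exists (fun x => c x * chi x); split => //.
apply: le_trans hfc.
rewrite [leRHS]Rintegral_mkcond; apply: le_Rintegral => //.
- by apply: bounded_csupp_integrable; apply: bounded_csupp_norm; apply: bounded_csuppB => //; exact: continuous_csupp_bounded_csupp.
- rewrite -restrict_EFin; apply/(integrable_mkcond _ mB); exact: ball_integrableB.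
- move=> x _; rewrite patchE; case: ifPn => hx; last first.
    move: hx; rewrite notin_setE /B /= => /negP; rewrite -ltNge => h.
    rewrite chi0// mulr0 subr0 f0 ?normr0//.
    by move: h; rewrite /L; have := ler_norm L0; lra.
  have -> : f x - c x * chi x = (f x - c x) * chi x.
    rewrite mulrBl; congr (_ - _); have [h|h] := leP `|x| L0; first by rewrite chi1// mulr1.
    by rewrite f0// mul0r.
  rewrite normrM ler_piMr//; have /andP[? ?] := chi01 x; by rewrite ger0_norm.
Qed.

(** * Convergence of mollifications in L^1 *)

Lemma conv_continuous_csupp f k : bounded_csupp f -> continuous_csupp k -> continuous_csupp (conv f k).
Proof.
move=> bf kc; split; first exact: conv_continuous.
have [_ _ [L f0]] := bf; have [_ [L' k0]] := kc.
exists (L + L') => x hx; rewrite /conv (_ : (fun y => _) = cst 0).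
  by rewrite Rintegral_cst// mul0r.
apply/funext => y; have [h|h] := ltP L `|y|; first by rewrite f0// mul0r.
rewrite k0 ?mulr0//; have := ler_normD (x - y) y; rewrite subrK; lra.
Qed.

(** Tonelli's theorem and the unit mass of the mollifier. Applied to the absolute value of a
    function, it says that mollifying does not increase the L^1 norm. *)
Lemma conv_mol_int f r : 0 < r -> bounded_csupp f -> (forall x, 0 <= f x) ->
  \int[mu]_x conv f (mol r) x = \int[mu]_x f x.
Proof.
move=> r0 bf f0; rewrite /Rintegral; congr fine.
have [mf _ _] := bf.
have mF : measurable_fun setT (fun z : 'rV[R]_N * 'rV[R]_N => (f z.2 * mol r (z.1 - z.2))%:E).
  apply/measurable_EFinP; apply: measurable_funM.
    exact: measurableT_comp mf measurable_snd.
  (* Measurability is needed for the product sigma-algebra on pairs, so the mollifier is expanded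
     into its coordinate factors. *)
  rewrite (_ : (fun z => _) = (fun z : 'rV[R]_N * 'rV[R]_N => \prod_(i < N) mol1 r (z.1 ord0 i - z.2 ord0 i))).
    apply: measurable_prod => i _.
    apply: measurableT_comp.
      by apply: continuous_measurable_fun; exact: smooth_continuous (smooth_mol1 r).
    apply: measurable_funB.
      exact: measurableT_comp (measurable_coord i) measurable_fst.
    exact: measurableT_comp (measurable_coord i) measurable_snd.
  by apply/funext => z; apply: eq_bigr => i _; rewrite !mxE.
have F0 (z : 'rV[R]_N * 'rV[R]_N) : (0 <= (f z.2 * mol r (z.1 - z.2))%:E)%E.
  by rewrite lee_fin mulr_ge0// mol_ge0.
transitivity (\int[mu]_x \int[mu]_y (f y * mol r (x - y))%:E)%E.
  apply: eq_integral => x _; rewrite /conv /Rintegral fineK//.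
  by apply: integrable_fin_num => //; apply: conv_integrable => //; exact: continuous_csupp_mol.
have := @fubini_tonelli _ _ _ _ _ mu mu _ mF F0; rewrite /= => ->.
apply: eq_integral => y _.
under eq_integral do rewrite EFinM.
rewrite ge0_integralZl ?lee_fin//.
- by rewrite mol_integral// mule1.
- by apply/measurable_EFinP; exact: measurable_mol.
- by move=> x _; rewrite lee_fin mol_ge0.
Qed.

Lemma conv_le_norm f k x : bounded_csupp f -> continuous_csupp k -> (forall x, 0 <= k x) ->
  `|conv f k x| <= conv (fun y => `|f y|) k x.
Proof.
move=> bf kc k0; apply: le_trans (le_normr_Rintegral _ _) _ => //.
  exact: conv_integrable.
rewrite le_eqVlt; apply/orP; left; apply/eqP; apply: eq_Rintegral => y _.
by rewrite normrM (ger0_norm (k0 _)).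
Qed.

Lemma convB f g k x : bounded_csupp f -> bounded_csupp g -> continuous_csupp k ->
  conv (fun y => f y - g y) k x = conv f k x - conv g k x.
Proof.
move=> bf bg kc; rewrite /conv -RintegralB//; try exact: conv_integrable.
by apply: eq_Rintegral => y _; rewrite mulrBl.
Qed.

(** With a continuous approximant [c], the difference splits into the mollification of [f - c], the
    difference between [c] and its mollification, and [-(f - c)]. The outer two have L^1 norm at
    most [e / 3] each, the middle one by uniform continuity of [c] on a ball of finite measure. *)
Lemma conv_mol_L1 f : bounded_csupp f -> forall e, 0 < e ->
  exists2 r0, 0 < r0 & forall r, 0 < r -> r < r0 ->
    \int[mu]_x `|conv f (mol r) x - f x| <= e.
Proof.
move=> bf e e0; have e30 : 0 < e / 3 by rewrite divr_gt0.
have [c [cc hc]] := dense_continuous_csupp bf e30.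
have bc := continuous_csupp_bounded_csupp cc.
have [ctc [L c0]] := cc.
pose B := [set x : 'rV[R]_N | `|x| <= L + 1].
have mB : measurable B by exact: measurable_norm_le.
have muB : (mu B < +oo)%E by exact: lebesgueN_ball_lty.
pose m := fine (mu B); have m0 : 0 <= m by rewrite fine_ge0.
have e1 : 0 < e / 3 / (m + 1) by rewrite divr_gt0// ltr_wpDl.
have [d d0 hd] := compact_support_unif ctc c0 e1.
(* The bound [r < 1] keeps the support of the mollified [c] in the ball of radius [L + 1]; the bound
   [r < d] makes the middle term small there. *)
exists (Num.min 1 d); first by rewrite lt_min ltr01.
move=> r r0; rewrite lt_min => /andP[r1 rd].
have mr := @continuous_csupp_mol R N r r0.
have bcv g : bounded_csupp g -> bounded_csupp (conv g (mol r)) by move=> bg; exact/continuous_csupp_bounded_csupp/conv_continuous_csupp.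
have bfc := bounded_csupp_norm (bounded_csuppB bf bc).
have iw : mu.-integrable setT (EFin \o (fun x => (cst (e / 3 / (m + 1)) \_ B) x)).
  rewrite -restrict_EFin; apply/(integrable_mkcond _ mB).
  apply: (@ball_integrable _ (cst (e / 3 / (m + 1))) `|e / 3 / (m + 1)|) => //.
apply: (@le_trans _ _ (\int[mu]_x (conv (fun y => `|f y - c y|) (mol r) x +
    (cst (e / 3 / (m + 1)) \_ B) x + `|f x - c x|))).
  apply: le_Rintegral => //.
  - by apply: bounded_csupp_integrable; apply: bounded_csupp_norm; apply: bounded_csuppB => //; exact: bcv.
  - have i1 := integrableD measurableT (bounded_csupp_integrable (bcv _ bfc)) iw.
    have := integrableD measurableT i1 (bounded_csupp_integrable bfc); by [].
  - move=> x _.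
    have -> : conv f (mol r) x - f x = conv (fun y => f y - c y) (mol r) x +
       (conv c (mol r) x - c x) - (f x - c x) by rewrite convB//; ring.
    apply: le_trans (ler_normB _ _) _; rewrite lerD2r.
    apply: le_trans (ler_normD _ _) _; apply: lerD.
      by apply: conv_le_norm => //; [exact: bounded_csuppB|exact: mol_ge0].
    rewrite patchE; case: ifPn => hx.
      apply: conv_mol_dist => // y xy; apply/ltW/hd; exact: lt_trans rd.
    move: hx; rewrite notin_setE /B /= => /negP; rewrite -ltNge => h.
    apply: conv_mol_dist => // y xy.
    rewrite c0; last by lra.
    rewrite c0; first by rewrite subrr normr0.
    have := ler_normD (x - y) y; rewrite subrK; lra.
have i1 := integrableD measurableT (bounded_csupp_integrable (bcv _ bfc)) iw.
rewrite RintegralD//; last exact: bounded_csupp_integrable.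
rewrite RintegralD//; last exact: bounded_csupp_integrable (bcv _ bfc).
rewrite conv_mol_int// -Rintegral_mkcond Rintegral_cst// -/m.
have : e / 3 / (m + 1) * m <= e / 3.
  rewrite -mulrA ler_piMr ?(ltW e30)// mulrC ler_pdivrMr ?mul1r ?lerDl// ltr_wpDl//.
lra.
Qed.

End density.

(** * Scalar and vector inequalities; Euclidean balls *)

Section powers.
Context {R : realType}.

(** The absolute value makes the function continuous on the whole line. Away from 0 the power is
    differentiable; at 0 the radius e^(1/a) is used directly. *)
Lemma continuous_powR_norm (a : R) : 0 < a -> continuous (fun t : R => `|t| `^ a).
Proof.
move=> a0 t; have [->|t0] := eqVneq t 0.
  apply/(@cvgrPdist_lt _ _ _ (nbhs (0:R))) => e e0.
  have h : 0 < e `^ a^-1 by exact: powR_gt0.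
  near=> s.
  have hs : `|s| < e `^ a^-1 by near: s; apply/nbhs_ballP; exists (e `^ a^-1) => // s; rewrite /ball /= sub0r normrN.
  rewrite normr0 powR0 ?gt_eqF// sub0r normrN ger0_norm ?powR_ge0//.
  rewrite -[ltRHS]powRr1 ?(ltW e0)// -(mulVf (lt0r_neq0 a0)) powRrM.
  by apply: gt0_ltr_powR; rewrite ?nnegrE ?powR_ge0.
have c1 : {for `|t|, continuous (fun s : R => s `^ a)}.
  apply: differentiable_continuous; apply/derivable1_diffP.
  by apply: derivable_powR; rewrite in_itv/= andbT normr_gt0.
exact: (continuous_comp (@norm_continuous _ _ t) c1).
Unshelve. all: end_near. Qed.

(** A compactness argument. On the part [Q] of the square [0, M]^2 where the left-hand side is at
    least [d], the continuous function [D] has a positive minimum: [D = 0] forces [s = t], as the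
    power [q] is injective on nonnegative reals, and then the left-hand side is 0. Outside [Q] the
    term [d] suffices, since [D] is nonnegative. *)
Lemma power_gap (q al M K d : R) : 0 < q -> 0 < al -> 0 <= M -> 0 <= K -> 0 < d ->
  exists2 C, 0 < C & forall s t, 0 <= s <= M -> 0 <= t <= M ->
    K * `|s `^ al - t `^ al| <= d + C * ((s `^ q - t `^ q) * (s - t)).
Proof.
move=> q0 al0 M0 K0 d0.
have Dpos (s t : R) : 0 <= s -> 0 <= t -> 0 <= (s `^ q - t `^ q) * (s - t).
  move=> s0 t0; have [st|st] := leP s t.
    rewrite -mulrNN mulr_ge0// oppr_ge0 subr_le0//.
    by apply: ge0_ler_powR; rewrite ?nnegrE ?(ltW q0).
  rewrite mulr_ge0// subr_ge0 ?(ltW st)//.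
  by apply: ge0_ler_powR; rewrite ?nnegrE ?(ltW q0) ?(ltW st).
pose D (z : R * R) : R := (`|z.1| `^ q - `|z.2| `^ q) * (z.1 - z.2).
pose F (z : R * R) : R := K * `| `|z.1| `^ al - `|z.2| `^ al |.
have cp (b : R) : 0 < b -> continuous (fun z : R * R => `|z.1| `^ b - `|z.2| `^ b).
  move=> b0.
  have c1 : continuous ((fun t : R => `|t| `^ b) \o (@fst R R)).
    by move=> z; apply: continuous_comp; [exact: cvg_fst|exact: continuous_powR_norm].
  have c2 : continuous ((fun t : R => `|t| `^ b) \o (@snd R R)).
    by move=> z; apply: continuous_comp; [exact: cvg_snd|exact: continuous_powR_norm].
  by move=> z; exact: (continuousB (c1 z) (c2 z)).
have c12 : continuous (fun z : R * R => z.1 - z.2).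
  by move=> z; apply: continuousB; [exact: cvg_fst|exact: cvg_snd].
have cD : continuous D.
  by move=> z; exact: (continuousM (cp _ q0 z) (c12 z)).
have cn : continuous ((fun t : R => `|t|) \o (fun z : R * R => `|z.1| `^ al - `|z.2| `^ al)).
  by move=> z; apply: continuous_comp; [exact: cp|exact: norm_continuous].
have cF : continuous F.
  by move=> z; exact: (continuousM (@cst_continuous _ _ K z) (cn z)).
pose Q := (`[0, M] `*` `[0, M]) `&` [set z | d <= F z].
have cQ : compact Q.
  apply: compact_closedI; first by apply: compact_setX; exact: segment_compact.
  rewrite (_ : [set z | _] = F @^-1` [set t | d <= t])//.
  by apply: preimage_closed; [move=> z _; exact: cF|exact: closed_ge].
have powM (s : R) : 0 <= s <= M -> 0 <= s `^ al <= M `^ al.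
  move=> /andP[s0 sM]; rewrite powR_ge0/=.
  by apply: ge0_ler_powR; rewrite ?nnegrE ?(ltW al0).
have [Q0|nQ] := pselect (Q !=set0).
  have [c /set_mem[[/= c1 c2] c3] hc] := compact_EVT_min Q0 cQ (continuous_subspaceT cD).
  rewrite /= !in_itv/= in c1 c2.
  have /andP[c10 _] := c1; have /andP[c20 _] := c2.
  have Dc : 0 < D c.
    rewrite lt_neqAle /D !ger0_norm// Dpos// andbT eq_sym mulf_neq0//; last first.
      rewrite subr_eq0; apply/eqP => E.
      by move: c3; rewrite /= /F E subrr normr0 mulr0; apply/negP; rewrite -ltNge.
    rewrite subr_eq0; apply/eqP => E.
    have E' : c.1 = c.2.
      have := congr1 (fun t => t `^ q^-1) E.
      by rewrite -!powRrM mulfV ?lt0r_neq0// !powRr1.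
    by move: c3; rewrite /= /F E' subrr normr0 mulr0; apply/negP; rewrite -ltNge.
  (* [K M^al] bounds the left-hand side on the whole square; adding 1 makes the constant
     positive. *)
  exists ((K * M `^ al + 1) / D c).
    by rewrite divr_gt0// ltr_wpDl// mulr_ge0// powR_ge0.
  move=> s t hs ht; have /andP[s0 _] := hs; have /andP[t0 _] := ht.
  have [h|h] := leP (K * `|s `^ al - t `^ al|) d.
    apply: le_trans h _; rewrite lerDl mulr_ge0 ?Dpos// divr_ge0 ?(ltW Dc)//.
    by rewrite addr_ge0// mulr_ge0// powR_ge0.
  have : D c <= D (s, t).
    apply: hc; rewrite inE; split; first by split; rewrite /= in_itv.
    by rewrite /= /F /= (ger0_norm s0) (ger0_norm t0) ltW.
  rewrite {2}/D /= (ger0_norm s0) (ger0_norm t0) => hD.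
  apply: (@le_trans _ _ (K * M `^ al)).
    rewrite ler_wpM2l//; have := powM _ hs; have := powM _ ht.
    by rewrite ler_norml; lra.
  have : (K * M `^ al + 1) / D c * D c <= (K * M `^ al + 1) / D c * ((s `^ q - t `^ q) * (s - t)).
    rewrite ler_wpM2l// divr_ge0 ?(ltW Dc)//.
    by rewrite addr_ge0// mulr_ge0// powR_ge0.
  rewrite divfK ?gt_eqF//; lra.
exists 1 => // s t hs ht; have /andP[s0 _] := hs; have /andP[t0 _] := ht.
rewrite mul1r; apply: ler_wpDr; first exact: Dpos.
rewrite leNgt; apply/negP => h; apply: nQ; exists (s, t); split.
  by split; rewrite /= in_itv.
by rewrite /= /F /= (ger0_norm s0) (ger0_norm t0) ltW.
Qed.

End powers.

Section vectors.
Context {R : realType} {N : nat}.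
Implicit Types x y : 'rV[R]_N.

Lemma dotvC x y : dotv x y = dotv y x.
Proof. by apply: eq_bigr => i _; rewrite mulrC. Qed.

Lemma dotvDl x y z : dotv (x + y) z = dotv x z + dotv y z.
Proof. by rewrite -big_split; apply: eq_bigr => i _; rewrite mxE mulrDl. Qed.

Lemma dotvZl a x y : dotv (a *: x) y = a * dotv x y.
Proof. by rewrite mulr_sumr; apply: eq_bigr => i _; rewrite mxE mulrA. Qed.

Lemma dotvBl x y z : dotv (x - y) z = dotv x z - dotv y z.
Proof. by rewrite dotvDl -scaleN1r dotvZl mulN1r. Qed.

Lemma dotvBr x y z : dotv z (x - y) = dotv z x - dotv z y.
Proof. by rewrite dotvC dotvBl !(dotvC z). Qed.

Lemma dotv_ge0 x : 0 <= dotv x x.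
Proof. by apply: sumr_ge0 => i _; rewrite -expr2 sqr_ge0. Qed.

Lemma enorm_ge0 x : 0 <= enorm x.
Proof. exact: sqrtr_ge0. Qed.

Lemma enorm_sqr x : enorm x ^+ 2 = dotv x x.
Proof. by rewrite sqr_sqrtr// dotv_ge0. Qed.

Lemma coord_le_enorm x i : `|x ord0 i| <= enorm x.
Proof.
rewrite -sqrtr_sqr ler_wsqrtr// /dotv (bigD1 i)//= expr2 lerDl.
by apply: sumr_ge0 => j _; rewrite -expr2 sqr_ge0.
Qed.

Lemma norm_le_enorm x r : 0 < r -> enorm x < r -> `|x| < r.
Proof. by move=> r0 xr; apply: rV_norm_lt => // i; exact: le_lt_trans (coord_le_enorm x i) xr. Qed.

Lemma enorm_le x M : (forall i, `|x ord0 i| <= M) -> enorm x <= Num.sqrt (N%:R * M ^+ 2).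
Proof.
move=> h; rewrite ler_wsqrtr// -[N in leRHS](card_ord N) mulr_natl -sumr_const.
apply: ler_sum => i _; rewrite -expr2 -[leLHS]real_normK ?num_real//.
by rewrite lerXn2r ?nnegrE// (le_trans _ (h i)).
Qed.

(** The square of the norm of |y| x - |x| y is nonnegative; expanding it and dividing by |x| |y|
    gives the bound when both norms are nonzero. *)
Lemma Cauchy_Schwarz_dotv x y : dotv x y <= enorm x * enorm y.
Proof.
have [x0|x0] := eqVneq (enorm x) 0.
  have h i : x ord0 i = 0 by apply/normr0_eq0/le_anti; rewrite normr_ge0 -x0 coord_le_enorm.
  by rewrite x0 mul0r /dotv big1// => i _; rewrite h mul0r.
have [y0|y0] := eqVneq (enorm y) 0.
  have h i : y ord0 i = 0 by apply/normr0_eq0/le_anti; rewrite normr_ge0 -y0 coord_le_enorm.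
  by rewrite y0 mulr0 /dotv big1// => i _; rewrite h mulr0.
have := dotv_ge0 (enorm y *: x - enorm x *: y).
rewrite dotvBl !dotvBr !dotvZl !(dotvC _ (_ *: _)) !dotvZl -!enorm_sqr (dotvC y x).
set a := enorm x in x0 *; set b := enorm y in y0 *.
have ab : 0 < a * b by rewrite mulr_gt0// lt0r ?x0 ?y0 enorm_ge0.
move=> h; rewrite -(ler_pM2l ab); nra.
Qed.

(** The right-hand side minus the left-hand side is (|x|^(p-2) + |y|^(p-2)) (|x| |y| - x.y), which
    is nonnegative by Cauchy-Schwarz. Monotonicity of the vector flux is thereby reduced to the two
    scalars |x| and |y|, to which [power_gap] applies. *)
Lemma pflux_monotone (p : R) x y : 1 < p ->
  (enorm x `^ (p - 1) - enorm y `^ (p - 1)) * (enorm x - enorm y) <=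
  dotv (pflux p x - pflux p y) (x - y).
Proof.
move=> p1; have p0 : 0 < p - 1 by lra.
rewrite /pflux dotvBl !dotvBr !dotvZl -!enorm_sqr (dotvC y x).
have E (z : 'rV[R]_N) : enorm z * enorm z `^ (p - 2) = enorm z `^ (p - 1) :> R.
  have -> : p - 2 = p - 1 - 1 by ring.
  by rewrite mulr_powRB1 ?enorm_ge0.
rewrite -(E x) -(E y).
have := Cauchy_Schwarz_dotv x y; have := powR_ge0 (enorm x) (p - 2); have := powR_ge0 (enorm y) (p - 2).
move: (enorm x) (enorm y) (_ `^ _) (_ `^ _) (dotv x y) => a b f g c f0 g0 h.
have := mulr_ge0 f0 (_ : 0 <= a * b - c); have := mulr_ge0 g0 (_ : 0 <= a * b - c).
by rewrite subr_ge0 => /(_ h) h1 /(_ h) h2; nra.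
Qed.

Lemma pflux_coord_le (p : R) x i : 1 < p -> `|pflux p x ord0 i| <= enorm x `^ (p - 1).
Proof.
move=> p1; rewrite mxE normrM ger0_norm ?powR_ge0//.
have -> : enorm x `^ (p - 1) = enorm x `^ (p - 2) * enorm x.
  have -> : p - 2 = p - 1 - 1 by ring.
  by rewrite mulrC mulr_powRB1// ?enorm_ge0//; lra.
by rewrite ler_wpM2l ?powR_ge0// coord_le_enorm.
Qed.

End vectors.

Section euclidean_balls.
Context {R : realType} {N : nat}.
Implicit Types x y c : 'rV[R]_N.
Local Notation delta i := (delta_mx ord0 i : 'rV[R]_N).

Lemma smooth_id : smooth (@id R).
Proof.
move=> [|k]; first by split => // x; exact: cvg_id.
split; first by move=> x; exact: cvg_id.
split; first by move=> x; exact: derivable_id.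
rewrite (_ : derive1 _ = fun=> 1 : R); first exact: smoothn_cst.
by apply/funext => x; rewrite derive1_id.
Qed.

(** A function of one coordinate is a product over all coordinates whose other factors are 1, so
    [Cn_prod_coord] applies. *)
Lemma Cn_coord k (F : R -> R) i : smooth F -> Cn k (fun x : 'rV[R]_N => F (x ord0 i)).
Proof.
move=> sF.
rewrite (_ : (fun x => _) = (fun x : 'rV[R]_N => \prod_(j < N) (if j == i then F else fun=> 1) (x ord0 j))).
  by apply: (@Cn_prod_coord _ _ k (fun j => if j == i then F else fun=> 1)) => j; case: ifP => // _; exact: smooth_cst.
apply/funext => x; rewrite (bigD1 i)//= eqxx big1 ?mulr1// => j /negbTE ji.
by rewrite ji.
Qed.

Lemma Cn_cst k (a : R) : Cn k (fun _ : 'rV[R]_N => a).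
Proof.
elim: k a => [|k IH] a; first by split => // x; exact: cst_continuous.
apply: (@CnS _ _ _ _ (fun _ _ => 0)) => //; first by move=> x; exact: cst_continuous.
Qed.

Lemma Cn_sum k (I : Type) (s : seq I) (f : I -> 'rV[R]_N -> R) :
  (forall i, Cn k (f i)) -> Cn k (fun x => \sum_(i <- s) f i x).
Proof.
move=> cf; elim: s => [|i s IH].
  rewrite (_ : (fun x => _) = (fun _ => 0)); first exact: Cn_cst.
  by apply/funext => x; rewrite big_nil.
rewrite (_ : (fun x => _) = (fun x => f i x + \sum_(j <- s) f j x)); first exact: CnD.
by apply/funext => x; rewrite big_cons.
Qed.

(** Defining function of a Euclidean ball. The balls of the topology are cubes, which in general do
    not have a smooth boundary, whereas the lower bound on [a] is assumed on smooth open sets. *)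
Definition ball_fun (c : 'rV[R]_N) (r : R) (x : 'rV[R]_N) : R := dotv (x - c) (x - c) - r ^+ 2.

Lemma Cinfty_ball_fun c r : Cinfty (ball_fun c r).
Proof.
move=> k; rewrite (_ : ball_fun c r = (fun x => \sum_(i < N)
    (fun t => (- c ord0 i + 1 * t) * (- c ord0 i + 1 * t)) (x ord0 i) + - r ^+ 2)); last first.
  by apply/funext => x; congr (_ + _); apply: eq_bigr => i _; rewrite !mxE mul1r addrC.
apply: CnD; last exact: Cn_cst.
apply: Cn_sum => i; apply: (@Cn_coord k (fun t => (- c ord0 i + 1 * t) * (- c ord0 i + 1 * t))).
by apply: smoothM; apply: (@smooth_affine _ id); exact: smooth_id.
Qed.

Lemma partial_ball_fun c r i y : partial i (ball_fun c r) y = 2 * (y ord0 i - c ord0 i).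
Proof.
have : is_derive y (delta i) (ball_fun c r) (2 * (y ord0 i - c ord0 i)).
  apply/is_derive_line.
  pose a := y ord0 i - c ord0 i.
  have d1 : is_derive (0 : R) 1 (fun t : R => a + 1 * t) 1.
    have := @is_derive_affine _ id a 1 0 1 _; by rewrite mulr1; apply.
  have d2 := is_deriveM d1 d1.
  have d3 := is_deriveD d2 (is_derive_cst (ball_fun c r y - a * a) (0:R) 1).
  rewrite (_ : (fun t : R => _) = (fun t => (a + 1 * t) * (a + 1 * t) + (ball_fun c r y - a * a))).
    rewrite (_ : 2 * a = ((a + 1 * 0) *: (1 : R) + (a + 1 * 0) *: (1:R)) + 0); first exact: d3.
    by rewrite /GRing.scale /=; ring.
  apply/funext => t; rewrite /ball_fun /dotv (bigD1 i)//= [in RHS](bigD1 i)//= !mxE !eqxx /=.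
  rewrite (eq_bigr (fun j => (y - c) ord0 j * (y - c) ord0 j)); last first.
    by move=> j /negbTE ji; rewrite !mxE ji andbF mulr0 add0r.
  rewrite /a; move: (\sum_(_ < _ | _) _) => S; ring.
by case.
Qed.

Definition eball (c : 'rV[R]_N) (r : R) : set 'rV[R]_N := [set x | ball_fun c r x < 0].

Lemma eballE c r x : 0 < r -> eball c r x = (enorm (x - c) < r) :> Prop.
Proof.
move=> r0; rewrite /eball /ball_fun /= subr_lt0 -enorm_sqr.
by rewrite ltr_pXn2r ?nnegrE ?enorm_ge0 ?(ltW r0).
Qed.

Lemma open_eball c r : open (eball c r).
Proof.
rewrite (_ : eball c r = ball_fun c r @^-1` [set t | t < 0])//.
by apply: open_comp; [move=> x _; exact: Cn_continuous (Cinfty_ball_fun c r 0) x|exact: open_lt].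
Qed.

Lemma closure_eball c r x : closure (eball c r) x -> ball_fun c r x <= 0.
Proof.
have cl : closed [set x | ball_fun c r x <= 0].
  rewrite (_ : [set _ | _] = ball_fun c r @^-1` [set t | t <= 0])//.
  by apply: preimage_closed; [move=> y _; exact: Cn_continuous (Cinfty_ball_fun c r 0) y|exact: closed_le].
have : eball c r `<=` [set x | ball_fun c r x <= 0] by move=> y /= /ltW.
by move=> /closure_subset h /h; rewrite -(closure_id _).1.
Qed.

(** The gradient of the defining function is 2 (y - c); it vanishes only at the centre, which is an
    interior point and so not on the boundary. *)
Lemma smooth_eball c r : 0 < r -> smooth_open (eball c r).
Proof.
move=> r0; split; first exact: open_eball.
move=> y [/closure_eball h1 h2]; exists setT, (ball_fun c r); split.
- exact: filterT.
- exact: Cinfty_ball_fun.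
- apply/eqP => g0.
  have yc i : y ord0 i = c ord0 i.
    have := congr1 (fun z : 'rV[R]_N => z ord0 i) g0; rewrite !mxE partial_ball_fun => /eqP.
    by rewrite mulf_eq0 pnatr_eq0/= subr_eq0 => /eqP.
  apply: h2; apply: open_eball; rewrite eballE//.
  by rewrite (_ : y - c = 0) /enorm /dotv ?big1 ?sqrtr0// => [i _|]; rewrite ?mxE ?mul0r//;
    apply/rowP => i; rewrite !mxE yc subrr.
- by [].
Qed.

Lemma eball_norm c r x : 0 < r -> closure (eball c r) x -> `|x - c| <= r.
Proof.
move=> r0 /closure_eball; rewrite /ball_fun subr_le0 -enorm_sqr ler_pXn2r ?nnegrE ?enorm_ge0 ?(ltW r0)// => h.
apply/ler_addgt0Pr => e e0; apply/ltW/norm_le_enorm; lra.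
Qed.

Lemma compactly_contained_eball c (U : set 'rV[R]_N) : open U -> U c ->
  exists2 r, 0 < r & compactly_contained (eball c r) U.
Proof.
move=> oU Uc; have /nbhs_ballP[e /= e0 he] := oU c Uc.
have e2 : 0 < e / 2 by rewrite divr_gt0.
exists (e / 2) => //; split.
  apply: bounded_closed_compact; last exact: closed_closure.
  exists (e / 2 + `|c|); split; first exact: num_real.
  move=> t ht x /= /(eball_norm e2) h.
  have := ler_normD (x - c) c; rewrite subrK; lra.
move=> x /(eball_norm e2) h; apply: he; rewrite mx_norm_ball /ball_ /= distrC; lra.
Qed.

(** The positivity set of the truncation has no regularity, so a property known on smooth open sets
    reaches it only through a finite cover by Euclidean balls. *)
Lemma compact_smooth_cover (U K : set 'rV[R]_N) : open U -> compact K -> K `<=` U ->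
  exists s : seq (set 'rV[R]_N), (forall O, O \in s -> smooth_open O /\ compactly_contained O U) /\
    forall x, K x -> exists2 O, O \in s & O x.
Proof.
move=> oU cK KU.
have /choice[r hr] : forall c, exists r, U c -> 0 < r /\ compactly_contained (eball c r) U.
  move=> c; have [Uc|nUc] := pselect (U c); last by exists 0.
  by have [r r0 h] := compactly_contained_eball oU Uc; exists r.
have := cK; rewrite compact_cover => /(_ _ U (fun c => eball c (r c)))[||D DK cov].
- by move=> c _; exact: open_eball.
- move=> x Kx; have [r0 _] := hr x (KU x Kx); exists x; first exact: KU.
  rewrite eballE// subrr /enorm /dotv big1 ?sqrtr0// => i _; by rewrite mxE mul0r.
exists [seq eball c (r c) | c <- finmap.enum_fset D]; split.
  move=> O /mapP[c cD ->]; have /set_mem Uc := DK c cD.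
  by have [r0 h] := hr c Uc; split => //; exact: smooth_eball.
move=> x /cov[c cD h]; exists (eball c (r c)) => //; apply/mapP; by exists c.
Qed.

End euclidean_balls.

(** * Truncation at a positive level *)

Section truncation.
Context {R : realType} {N : nat}.
Implicit Types (U V Z : set 'rV[R]_N) (z f : 'rV[R]_N -> R).
Local Notation mu := (@lebesgueN R N).

Definition trunc U z (k : R) : 'rV[R]_N -> R :=
  fun x => if `[< U x >] then Num.max 0 (z x - k) else 0.

Lemma trunc_ge0 U z k x : 0 <= trunc U z k x.
Proof. by rewrite /trunc; case: asboolP => // _; rewrite le_max lexx. Qed.

Lemma trunc_gt0 U z k x : 0 < trunc U z k x -> U x /\ k < z x /\ trunc U z k x = z x - k.
Proof.
rewrite /trunc; case: asboolP; last by rewrite ltxx.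
move=> Ux; rewrite lt_max ltxx/= => h; split => //; rewrite -subr_gt0; split => //.
by rewrite max_r// ltW.
Qed.

Lemma truncE U z k x : U x -> k <= z x -> trunc U z k x = z x - k.
Proof. by move=> Ux h; rewrite /trunc asboolT// max_r// subr_ge0. Qed.

Definition nonpos_bdry U z := forall y, bdry U y ->
  exists2 l : \bar R, (l <= 0)%E & (z x)%:E @[x --> within U (nbhs y)] --> l.

(** The boundary condition enters here: near a boundary point the limit is at most 0, hence [z < k]
    on the nearby part of [U]. A positive level is essential because the limit may be 0. Points
    outside the closure have a neighbourhood that misses [U]. *)
Lemma trunc_near0 U z k : open U -> nonpos_bdry U z -> 0 < k ->
  forall x, ~ U x -> \forall y \near x, trunc U z k y = 0.
Proof.
move=> oU bz k0 x nUx; have [cx|ncx] := pselect (closure U x); last first.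
  have : nbhs x (~` closure U) by apply: open_nbhs_nbhs; split => //; apply: closed_openC; exact: closed_closure.
  apply: filterS => y ncy; rewrite /trunc; case: asboolP => // Uy; exfalso.
  by apply: ncy; exact: subset_closure.
have [|l l0 hl] := bz x.
  by split => //; move=> /interior_subset.
have : nbhs l [set t | (t < k%:E)%E].
  by apply: open_nbhs_nbhs; split; [exact: open_ereal_lt_ereal|exact: le_lt_trans l0 _].
move=> /hl H; have {}H : nbhs x [set y | U y -> ((z y)%:E < k%:E)%E] by exact: H.
apply: filterS H => y h; rewrite /trunc; case: asboolP => // /h.
by rewrite lte_fin => zk; rewrite max_l// subr_le0 ltW.
Qed.

Lemma trunc_continuous U z k : open U -> {within U, continuous z} -> nonpos_bdry U z -> 0 < k ->
  continuous (trunc U z k).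
Proof.
move=> oU cz bz k0 x; have [Ux|nUx] := pselect (U x); last first.
  have h := trunc_near0 oU bz k0 nUx.
  have E : trunc U z k x = 0 by rewrite /trunc asboolF.
  rewrite /continuous_at E; exact: (@cvg_near_cst _ _ (0:R) (trunc U z k) (nbhs x) _ h).
rewrite continuous_open_subspace// in cz.
have cx : z y @[y --> nbhs x] --> z x by apply: cz; rewrite inE.
have c1 : (fun y => z y - k) y @[y --> nbhs x] --> z x - k.
  by apply: cvgB => //; exact: cvg_cst.
have c2 : (fun y => Num.max 0 (z y - k)) y @[y --> nbhs x] --> Num.max 0 (z x - k).
  exact: (@continuous_max _ _ (cst 0) (fun y => z y - k) x (@cst_continuous _ _ _ x) c1).
rewrite /continuous_at {2}/trunc asboolT//.
have ne : \forall y \near nbhs x, Num.max 0 (z y - k) = trunc U z k y.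
  by have : nbhs x U := oU x Ux; apply: filterS => y Uy; rewrite /trunc asboolT.
exact: cvg_trans (near_eq_cvg ne) c2.
Qed.

Lemma bounded_set_norm U : bounded_set U -> exists L, forall x, U x -> `|x| <= L.
Proof.
move=> [M [_ h]]; exists (M + 1) => x Ux; apply: (h (M + 1)) => //; by rewrite ltrDl.
Qed.

Lemma bounded_compact_closure U : bounded_set U -> compact (closure U).
Proof.
move=> /bounded_set_norm[L hL]; apply: bounded_closed_compact; last exact: closed_closure.
exists L; split; first exact: num_real.
move=> t Lt x cx; apply: le_trans (ltW Lt).
have : closure [set x : 'rV[R]_N | `|x| <= L] x by apply: closure_subset cx.
by rewrite -(closure_id _).1//; exact: closed_norm_le.
Qed.

Lemma trunc_compactly_contained U z k : open U -> bounded_set U -> nonpos_bdry U z -> 0 < k ->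
  compactly_contained [set x | 0 < trunc U z k x] U.
Proof.
move=> oU bU bz k0; split.
  have sub : closure [set x | 0 < trunc U z k x] `<=` closure U.
    by apply: closure_subset => x /= /trunc_gt0[].
  apply: (subclosed_compact _ (bounded_compact_closure bU) sub); exact: closed_closure.
move=> x cx; apply: contrapT => nUx.
by have [y [/= h1 h2]] := cx _ (trunc_near0 oU bz k0 nUx); rewrite h2 ltxx in h1.
Qed.

Lemma compactly_contained_sub U V W : V `<=` W -> compactly_contained W U -> compactly_contained V U.
Proof.
move=> VW [cW WU]; split; last by move=> x /(closure_subset VW)/WU.
by apply: (subclosed_compact _ cW); [exact: closed_closure|exact: closure_subset].
Qed.

(** The null set [Z] collects all exceptional points, so that almost-everywhere bounds on [V] become
    pointwise bounds on the new domain of integration. *)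
Lemma Rintegral_ae_restrict U V Z f : measurable U -> measurable V -> V `<=` U ->
  measurable Z -> mu Z = 0%E -> measurable_fun U f -> (forall x, U x -> ~ V x -> f x = 0) ->
  \int[mu]_(x in U) f x = \int[mu]_(x in V `\` Z) f x.
Proof.
move=> mU mV VU mZ Z0 mf f0.
have mVZ : measurable (V `\` Z) by exact: measurableD.
have -> : V `\` Z = U `&` (V `\` Z) by rewrite setIidr// => x [/VU].
rewrite Rintegral_mkcondr /Rintegral; congr fine; apply: ae_eq_integral => //.
- exact/measurable_EFinP.
- apply/measurable_EFinP.
  have := (measurable_restrict f mVZ mU).1; apply.
  by apply: measurable_funS mf => //; exact: subIsetl.
- exists Z; split => // x /= /not_implyP[Ux]; rewrite patchE; case: ifPn => //.
  rewrite notin_setE /= => h1 h2; apply: contrapT => nZ.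
  have nV : ~ V x by move=> Vx; apply: h1.
  by apply: h2; rewrite f0.
Qed.

(* The mollification of the indicator function of a large ball is constant
   near [x], so its partial derivatives vanish there. *)
Lemma mol_deriv_int r (x : 'rV[R]_N) i : 0 < r -> \int[mu]_y partial i (@mol R N r) (x - y) = 0.
Proof.
move=> r0; pose L := `|x| + r + r + 1.
pose f : 'rV[R]_N -> R := \1_[set y : 'rV[R]_N | `|y| <= L].
have bf : bounded_csupp f.
  split.
  - by apply: measurable_indic; exact: measurable_norm_le.
  - by exists 1 => y; rewrite /f indicE; case: (_ \in _); rewrite /= ?normr1 ?normr0.
  - by exists L => y hy; rewrite /f indicE memNset//= leNgt hy.
have mr := @continuous_csupp_mol R N r r0.
have near1 : \forall x' \near x, conv f (mol r) x' = cst 1 x'.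
  apply/nbhs_ballP; exists 1 => //= x'; rewrite mx_norm_ball /ball_ /= => hx.
  have f1 y : `|x' - y| < r -> f y = 1.
    move=> hy; rewrite /f indicE mem_set//= /L.
    have := ler_normB x (x - x'); rewrite opprB addrCA subrr addr0.
    have := ler_normB x' (x' - y); rewrite opprB addrCA subrr addr0.
    lra.
  apply/le_anti/andP; split.
    by apply: conv_mol_le => // y /f1 ->.
  by apply: conv_mol_ge => // y /f1 ->.
have d0 : is_derive x (delta_mx ord0 i) (conv f (mol r)) 0.
  apply: (@near_eq_is_derive _ _ _ (cst (1:R))).
  by apply: filterS near1.
have d1 := conv_partial i x bf mr (Cinfty_mol r 1).
have E : conv f (partial i (mol r)) x = 0.
  by case: d0 => _ <-; case: d1 => _ <-.
rewrite -[RHS]E /conv; apply: eq_Rintegral => y _.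
have [hy|hy] := leP `|x - y| r; last by rewrite (@partial_eq0 _ _ _ i r)// ?mulr0// => w hw; apply: mol_eq0 => //; exact: ltW.
rewrite /f indicE mem_set/= ?mul1r// /L.
have := ler_normB x (x - y); rewrite opprB addrCA subrr addr0; lra.
Qed.

End truncation.

(** * Weak gradients and mollification *)

Section weak_gradients.
Context {R : realType} {N : nat}.
Implicit Types (U V Z : set 'rV[R]_N) (f g : 'rV[R]_N -> R).
Local Notation mu := (@lebesgueN R N).

Lemma compactly_contained_norm V U : compactly_contained V U ->
  exists L, forall x, V x -> `|x| <= L.
Proof.
move=> [cV _]; have := @compact_bounded R _ _ cV => /bounded_set_norm[L hL].
by exists L => x Vx; apply: hL; exact: subset_closure.
Qed.

Lemma bounded_csupp_patch U E f M L : measurable U -> measurable E -> E `<=` U ->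
  measurable_fun U f -> (forall x, E x -> `|f x| <= M) -> (forall x, E x -> `|x| <= L) ->
  bounded_csupp (f \_ E).
Proof.
move=> mU mE EU mf fM EL; split.
- have mfE := measurable_funS mU EU mf.
  exact: ((measurable_restrictT _ mE).1 mfE).
- exists `|M| => x; rewrite patchE; case: ifPn => hx; last by rewrite normr0.
  by apply: le_trans (fM x _) (ler_norm _); rewrite inE in hx.
- exists L => x hx; rewrite patchE; case: ifPn => // /set_mem/EL; by rewrite leNgt hx.
Qed.

Lemma continuous_csupp_partial_mol r i : 0 < r -> continuous_csupp (partial i (@mol R N r)).
Proof.
move=> r0; split; first exact: Cn_continuous (Cn_partial i (Cinfty_mol r 1)).
by exists r; apply: partial_eq0 => x /ltW; exact: mol_eq0.
Qed.

Lemma measurable_continuous_csupp_reflect k x : continuous_csupp k -> measurable_fun setT (fun y : 'rV[R]_N => k (x - y)).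
Proof. by move=> kc; apply: measurable_fun_continuous_rV; case: (continuous_csupp_reflect x kc). Qed.

Lemma set_integrable V f M L : measurable V -> measurable_fun V f ->
  (forall x, V x -> `|f x| <= M) -> (forall x, V x -> `|x| <= L) ->
  mu.-integrable V (EFin \o f).
Proof.
move=> mV mf fM VL; apply: (@bounded_integrable _ _ _ _ M L) => //.
by move=> x /VL; rewrite leNgt => /negP.
Qed.

Lemma set_integrableM U V f k x M L : measurable U -> measurable V -> V `<=` U ->
  measurable_fun U f -> (forall y, V y -> `|f y| <= M) -> (forall y, V y -> `|y| <= L) ->
  continuous_csupp k -> mu.-integrable V (EFin \o (fun y => f y * k (x - y))).
Proof.
move=> mU mV VU mf fM VL kc; have [C kC] := continuous_csupp_bounded kc.
apply: (@set_integrable _ _ (M * C) L) => //.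
  apply: measurable_funM; first exact: measurable_funS mf.
  by apply: measurable_funTS; exact: measurable_continuous_csupp_reflect.
by move=> y Vy; rewrite normrM ler_pM// fM.
Qed.

Lemma mol_test_function U V r x : 0 < r -> compactly_contained V U ->
  (forall y, `|x - y| < r -> V y) -> test_function U (fun y => mol r (x - y)).
Proof.
move=> r0 VU xV; split; first exact: Cinfty_mol_reflect.
apply: compactly_contained_sub VU => y /= h; apply: xV; rewrite ltNge.
by apply: contra h => h; rewrite mol_eq0.
Qed.

(** The weak gradient is tested with the reflected mollifier [y |-> mol r (x - y)]. Differentiating
    the reflection produces a sign that cancels the one in the integration by parts. *)
Lemma weak_gradient_conv U V Z f (F : 'rV[R]_N -> 'rV[R]_N) i r x Mf M :
  open U -> open V -> compactly_contained V U -> measurable Z -> mu Z = 0%E ->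
  W1infty_loc U f F -> (forall y, V y -> `|f y| <= Mf) ->
  (forall y, (V `\` Z) y -> `|F y ord0 i| <= M) ->
  0 < r -> (forall y, `|x - y| <= r -> V y) ->
  \int[mu]_(y in V) (f y * partial i (mol r) (x - y)) =
  \int[mu]_(y in V `\` Z) (F y ord0 i * mol r (x - y)).
Proof.
move=> oU oV VU mZ Z0 [[mf _] mF wg] fM FM r0 xV.
have mU := measurable_open_rV oU; have mV := measurable_open_rV oV.
have VsU : V `<=` U by move=> y Vy; apply: (VU.2); exact: subset_closure.
have [L VL] := compactly_contained_norm VU.
have xV' y : `|x - y| < r -> V y by move=> /ltW/xV.
have tf := mol_test_function r0 VU xV'.
have mr := @continuous_csupp_mol R N r r0.
have pr := @continuous_csupp_partial_mol r i r0.
have [mFi _] := mF i.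
have nV y : ~ V y -> r < `|x - y| by move=> nVy; rewrite ltNge; apply/negP => /xV.
have := wg i _ tf.
under eq_Rintegral do rewrite partial_mol_reflect.
rewrite (@Rintegral_ae_restrict _ _ U V Z (fun y => F y ord0 i * _))//; last 2 first.
- apply: measurable_funM => //; apply: measurable_funTS; exact: measurable_continuous_csupp_reflect.
- by move=> y _ /nV/ltW h; rewrite mol_eq0// mulr0.
rewrite (@Rintegral_ae_restrict _ _ U V set0 (fun y => f y * _))//; last 2 first.
- apply: measurable_funM => //; apply: measurable_funTS; apply: measurableT_comp => //.
  exact: measurable_continuous_csupp_reflect.
- move=> y _ /nV h; rewrite (@partial_eq0 _ _ _ i r _ _ h) ?oppr0 ?mulr0// => w /ltW.
  exact: mol_eq0.
rewrite setD0 => h; apply: oppr_inj; rewrite -h.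
rewrite -mulN1r -RintegralZl//; last exact: (set_integrableM x mU mV VsU mf fM VL pr).
by apply: eq_Rintegral => y _; rewrite mulN1r mulrN.
Qed.

(** The derivative falls on the mollifier, whose support around [x] lies in [V], where [g] is
    [u - v - k]. The constant [k] contributes nothing by [mol_deriv_int], and the weak gradients of
    [u] and [v] give the rest; no differentiability of [g] is involved. *)
Lemma partial_conv_weak U V Z u v (Du Dv : 'rV[R]_N -> 'rV[R]_N) g (k : R) i r x Mu Mv M :
  open U -> open V -> compactly_contained V U -> measurable Z -> mu Z = 0%E ->
  W1infty_loc U u Du -> W1infty_loc U v Dv ->
  (forall y, V y -> `|u y| <= Mu) -> (forall y, V y -> `|v y| <= Mv) ->
  (forall y, (V `\` Z) y -> `|Du y ord0 i| <= M) ->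
  (forall y, (V `\` Z) y -> `|Dv y ord0 i| <= M) ->
  bounded_csupp g -> (forall y, V y -> g y = u y - v y - k) ->
  0 < r -> (forall y, `|x - y| <= r -> V y) ->
  partial i (conv g (mol r)) x =
  conv ((fun y => Du y ord0 i - Dv y ord0 i) \_ (V `\` Z)) (mol r) x.
Proof.
move=> oU oV VU mZ Z0 hu hv uM vM DuM DvM bg gE r0 xV.
have mU := measurable_open_rV oU; have mV := measurable_open_rV oV.
have VsU : V `<=` U by move=> y Vy; apply: (VU.2); exact: subset_closure.
have [L VL] := compactly_contained_norm VU.
have mr := @continuous_csupp_mol R N r r0.
have pr := @continuous_csupp_partial_mol r i r0.
have p0 y : ~ V y -> partial i (mol r) (x - y) = 0.
  move=> nVy; apply: (@partial_eq0 _ _ _ i r); last by rewrite ltNge; apply/negP => /xV.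
  by move=> w /ltW; exact: mol_eq0.
have toV f : \int[mu]_y (f y * partial i (mol r) (x - y)) = \int[mu]_(y in V) (f y * partial i (mol r) (x - y)).
  rewrite [RHS]Rintegral_mkcond; apply: eq_Rintegral => y _; rewrite patchE.
  case: ifPn => //; rewrite notin_setE => nVy; by rewrite p0// mulr0.
have [[mu_ _] mDu _] := hu; have [[mv_ _] mDv _] := hv.
have [mDui _] := mDu i; have [mDvi _] := mDv i.
transitivity (conv g (partial i (mol r)) x).
  by have [_] := conv_partial i x bg mr (Cinfty_mol r 1).
rewrite /conv toV.
have mE : measurable (V `\` Z) by exact: measurableD.
have EU : V `\` Z `<=` U by move=> y [/VsU].
have EL y : (V `\` Z) y -> `|y| <= L by move=> [/VL].
transitivity (\int[mu]_(y in V) (u y * partial i (mol r) (x - y) - v y * partial i (mol r) (x - y)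
    - k * partial i (mol r) (x - y))).
  by apply: eq_Rintegral => y; rewrite inE => Vy; rewrite gE//; ring.
have i1 := set_integrableM x mU mV VsU mu_ uM VL pr.
have i2 := set_integrableM x mU mV VsU mv_ vM VL pr.
have ik : forall y, V y -> `|cst k y| <= `|k| by [].
have mk : measurable_fun U (cst k) by [].
have i3 := set_integrableM x mU mV VsU mk ik VL pr.
rewrite RintegralB//; last first.
  have := integrableB mV i1 i2; by [].
rewrite RintegralB//.
have -> : \int[mu]_(y in V) (k * partial i (mol r) (x - y)) = 0.
  rewrite -(toV (cst k)) /= RintegralZl//; last by apply: bounded_csupp_integrable; exact/continuous_csupp_bounded_csupp/continuous_csupp_reflect.
  by rewrite mol_deriv_int// mulr0.
rewrite subr0.
rewrite (weak_gradient_conv oU oV VU mZ Z0 hu uM DuM r0 xV).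
rewrite (weak_gradient_conv oU oV VU mZ Z0 hv vM DvM r0 xV).
rewrite -RintegralB//; last 2 first.
- exact: (set_integrableM x mU mE EU mDui DuM EL mr).
- exact: (set_integrableM x mU mE EU mDvi DvM EL mr).
rewrite Rintegral_mkcond; apply: eq_Rintegral => y _; rewrite !patchE.
by case: ifP => _; [rewrite mulrBl|rewrite mul0r].
Qed.

End weak_gradients.

(** * The comparison principle *)

Section comparison.
Context {R : realType} {N : nat}.
Implicit Types (U V Z : set 'rV[R]_N) (f g : 'rV[R]_N -> R).
Local Notation mu_N := (@lebesgueN R N).

Lemma measurable_enorm U (F : 'rV[R]_N -> 'rV[R]_N) :
  (forall i, measurable_fun U (fun x => F x ord0 i)) -> measurable_fun U (fun x => enorm (F x)).
Proof.
move=> mF; apply: (measurableT_comp (f := @Num.sqrt R)).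
  by apply: continuous_measurable_fun; exact: sqrt_continuous.
by apply: measurable_sum => i; exact: measurable_funM.
Qed.

Lemma measurable_enorm_powR U (F : 'rV[R]_N -> 'rV[R]_N) (q : R) :
  (forall i, measurable_fun U (fun x => F x ord0 i)) ->
  measurable_fun U (fun x => enorm (F x) `^ q).
Proof.
move=> mF; apply: (measurableT_comp (f := fun t : R => t `^ q)); first exact: measurable_powR.
exact: measurable_enorm.
Qed.

(** On [V] minus [Z] all coefficients and gradients are bounded, so both integrands are integrable
    there and merge into one. This permits a pointwise comparison of the weak forms of [u] and
    [v]. *)
Lemma weak_form_restrict U V Z (p al mu : R) (h : R -> R) (a b w : 'rV[R]_N -> R)
    (Dw : 'rV[R]_N -> 'rV[R]_N) (phi : 'rV[R]_N -> R) Ma Mb Mh M :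
  open U -> open V -> compactly_contained V U -> measurable Z -> mu_N Z = 0%E ->
  1 < p -> 0 <= al -> continuous h ->
  measurable_fun U a -> measurable_fun U b -> W1infty_loc U w Dw ->
  (forall x, (V `\` Z) x -> `|a x| <= Ma) -> (forall x, (V `\` Z) x -> `|b x| <= Mb) ->
  (forall x, (V `\` Z) x -> `|h (w x)| <= Mh) ->
  (forall x, (V `\` Z) x -> enorm (Dw x) <= M) ->
  Cn 1 phi -> (forall x, ~ V x -> phi x = 0) -> (forall x i, ~ V x -> partial i phi x = 0) ->
  let I x := dotv (pflux p (Dw x)) (grad phi x) +
    (a x * h (w x) + mu * b x * enorm (Dw x) `^ al) * phi x in
  mu_N.-integrable (V `\` Z) (EFin \o I) /\
  weak_form U p al mu h a b w Dw phi = \int[mu_N]_(x in V `\` Z) I x.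
Proof.
move=> oU oV VU mZ Z0 p1 al0 ch ma mb [[mw _] mDw _] aM bM hM DM cphi phi0 dphi0 I.
have mU := measurable_open_rV oU; have mV := measurable_open_rV oV.
have VsU : V `<=` U by move=> y Vy; apply: (VU.2); exact: subset_closure.
have [L VL] := compactly_contained_norm VU.
have mE : measurable (V `\` Z) by exact: measurableD.
have EU : V `\` Z `<=` U by move=> y [/VsU].
have EL y : (V `\` Z) y -> `|y| <= L by move=> [/VL].
have mDi i : measurable_fun U (fun x => Dw x ord0 i) by case: (mDw i).
have L0 x : L < `|x| -> ~ V x by move=> + /VL; rewrite ltNge => /negP.
have kphi : continuous_csupp phi.
  by split; [exact: Cn_continuous cphi|exists L => x /L0; exact: phi0].
have kd i : continuous_csupp (partial i phi).
  split; first exact: Cn_continuous (Cn_partial i cphi).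
  by exists L => x /L0; exact: dphi0.
have mphi : measurable_fun U phi.
  by apply: measurable_funTS; apply: measurable_fun_continuous_rV; case: kphi.
have mdphi i : measurable_fun U (partial i phi).
  by apply: measurable_funTS; apply: measurable_fun_continuous_rV; case: (kd i).
have [P phiP] := continuous_csupp_bounded kphi.
have /choice[Q dphiQ] : forall i, exists Q, forall x, `|partial i phi x| <= Q.
  by move=> i; exact: continuous_csupp_bounded.
pose I1 x := dotv (pflux p (Dw x)) (grad phi x).
pose I2 x := (a x * h (w x) + mu * b x * enorm (Dw x) `^ al) * phi x.
have mI1 : measurable_fun U I1.
  rewrite (_ : I1 = fun x => \sum_(i < N) enorm (Dw x) `^ (p - 2) * Dw x ord0 i * partial i phi x).
    apply: measurable_sum => i; apply: measurable_funM => //; apply: measurable_funM => //.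
    exact: measurable_enorm_powR.
  by apply/funext => x; apply: eq_bigr => i _; rewrite !mxE.
have mI2 : measurable_fun U I2.
  apply: measurable_funM => //; apply: measurable_funD.
    apply: measurable_funM => //; apply: measurableT_comp => //.
    exact: continuous_measurable_fun.
  apply: measurable_funM; last exact: measurable_enorm_powR.
  exact: measurable_funM.
have i1 : mu_N.-integrable (V `\` Z) (EFin \o I1).
  apply: (@set_integrable _ _ _ _ (\sum_(i < N) M `^ (p - 1) * Q i) L) => //.
    exact: measurable_funS mI1.
  move=> x Ex; apply: le_trans (ler_norm_sum _ _ _) _; apply: ler_sum => i _.
  rewrite normrM; apply: ler_pM => //; last by rewrite mxE.
  apply: le_trans (pflux_coord_le _ _ p1) _.
  by apply: ge0_ler_powR; rewrite ?nnegrE ?enorm_ge0 ?DM//; [lra|exact: le_trans (enorm_ge0 _) (DM _ Ex)].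
have i2 : mu_N.-integrable (V `\` Z) (EFin \o I2).
  apply: (@set_integrable _ _ _ _ ((Ma * Mh + `|mu| * Mb * M `^ al) * P) L) => //.
    exact: measurable_funS mI2.
  move=> x Ex; rewrite normrM; apply: ler_pM => //.
  apply: le_trans (ler_normD _ _) _; rewrite !normrM; apply: lerD.
    by apply: ler_pM => //; [exact: aM|exact: hM].
  apply: ler_pM => //.
    by apply: ler_pM => //; exact: bM.
  rewrite ger0_norm ?powR_ge0//.
  by apply: ge0_ler_powR; rewrite ?nnegrE ?enorm_ge0 ?DM//; exact: le_trans (enorm_ge0 _) (DM _ Ex).
split; first by have := integrableD mE i1 i2.
rewrite /weak_form.
rewrite (@Rintegral_ae_restrict _ _ U V Z I1)//; last first.
  by move=> x _ nV; rewrite /I1 /dotv big1// => i _; rewrite [grad _ _ _ _]mxE dphi0// mulr0.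
rewrite (@Rintegral_ae_restrict _ _ U V Z I2)//; last first.
  by move=> x _ nV; rewrite /I2 phi0// mulr0.
by rewrite -RintegralD.
Qed.

Lemma sum_abs_lower (F G : 'I_N -> R) T : (forall i, `|F i| <= T) ->
  - (T * \sum_(i < N) `|G i|) <= \sum_(i < N) F i * G i.
Proof.
move=> FT; rewrite mulr_sumr -sumrN; apply: ler_sum => i _.
have := ler_norm (- (F i * G i)); rewrite normrN normrM => h.
have : `|F i| * `|G i| <= T * `|G i| by rewrite ler_wpM2r.
lra.
Qed.

(** Here [xi] and [eta] stand for the two gradients at a point, [G] for the mollified difference of
    gradients, [psi] and [dpsi] for the values of Psi and Psi'. Replacing [G] by [xi - eta] costs
    the error sum. The flux term then contributes at least [C psi] times the scalar monotonicity
    gap, the gradient term takes away at most [d psi] plus that same quantity, and the zero-order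
    term brings [2 d psi]; what remains is [d psi]. *)
Lemma pointwise_lower (p al mu C K T P d a b hu hv psi dpsi : R) (xi eta G : 'rV[R]_N) :
  1 < p -> 0 <= psi -> 0 <= C -> C * psi <= dpsi -> dpsi <= P ->
  2 * d <= a * (hu - hv) -> `|mu * b| <= K ->
  K * `|enorm xi `^ al - enorm eta `^ al| <= d + C * ((enorm xi `^ (p - 1) - enorm eta `^ (p - 1)) *
     (enorm xi - enorm eta)) ->
  enorm xi `^ (p - 1) <= T -> enorm eta `^ (p - 1) <= T ->
  d * psi - 2 * T * P * \sum_(i < N) `|G ord0 i - (xi ord0 i - eta ord0 i)| <=
  (dotv (pflux p xi) (dpsi *: G) + (a * hu + mu * b * enorm xi `^ al) * psi) -
  (dotv (pflux p eta) (dpsi *: G) + (a * hv + mu * b * enorm eta `^ al) * psi).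
Proof.
move=> p1 psi0 C0 Cpsi dP ahd bK gap xT eT.
have dpsi0 : 0 <= dpsi by apply: le_trans Cpsi; exact: mulr_ge0.
have P0 : 0 <= P by exact: le_trans dP.
set X := pflux p xi; set Y := pflux p eta.
set D1 := (enorm xi `^ (p - 1) - enorm eta `^ (p - 1)) * (enorm xi - enorm eta) in gap *.
have D1le : D1 <= dotv (X - Y) (xi - eta) by exact: pflux_monotone.
have D10 : 0 <= D1.
  rewrite /D1; have [st|st] := leP (enorm xi) (enorm eta).
    rewrite -mulrNN mulr_ge0// oppr_ge0 subr_le0//.
    by apply: ge0_ler_powR; rewrite ?nnegrE ?enorm_ge0//; lra.
  rewrite mulr_ge0// subr_ge0 ?(ltW st)//.
  by apply: ge0_ler_powR; rewrite ?nnegrE ?enorm_ge0 ?(ltW st)//; lra.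
set S := \sum_(i < N) _.
have S0 : 0 <= S by apply: sumr_ge0.
have T0 : 0 <= T by apply: le_trans xT; exact: powR_ge0.
have XY : - (2 * T * S) <= dotv (X - Y) (G - (xi - eta)).
  have : - (2 * T * S) <= \sum_(i < N) (X - Y) ord0 i * (G ord0 i - (xi ord0 i - eta ord0 i)).
    apply: sum_abs_lower => i; rewrite !mxE.
    apply: le_trans (ler_normB _ _) _.
    have := le_trans (pflux_coord_le xi i p1) xT; have := le_trans (pflux_coord_le eta i p1) eT.
    by rewrite !mxE; lra.
  by congr (_ <= _); apply: eq_bigr => i _; rewrite !mxE.
(* Splits the flux difference tested with [G] into the error part and the monotone part. *)
have E1 : dotv X (dpsi *: G) - dotv Y (dpsi *: G) =
    dpsi * dotv (X - Y) (G - (xi - eta)) + dpsi * dotv (X - Y) (xi - eta).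
  rewrite -dotvBl dotvC dotvZl dotvC -mulrDr; congr (_ * _).
  by rewrite !dotvBr; ring.
have h1 : - (2 * T * P * S) <= dpsi * dotv (X - Y) (G - (xi - eta)).
  apply: (@le_trans _ _ (dpsi * - (2 * T * S))); last by rewrite ler_wpM2l.
  have : dpsi * (2 * T * S) <= P * (2 * T * S) by rewrite ler_wpM2r// !mulr_ge0.
  lra.
have h2 : C * psi * D1 <= dpsi * dotv (X - Y) (xi - eta).
  by apply: ler_pM => //; exact: mulr_ge0.
have h3 : - (d + C * D1) <= mu * b * (enorm xi `^ al - enorm eta `^ al).
  apply: (@le_trans _ _ (- (K * `|enorm xi `^ al - enorm eta `^ al|))); first by rewrite lerN2.
  rewrite lerNl; apply: le_trans (ler_norm _) _; rewrite normrN normrM.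
  by rewrite ler_wpM2r.
have h4 : (2 * d) * psi <= a * (hu - hv) * psi by rewrite ler_wpM2r.
have h5 : - (d + C * D1) * psi <= mu * b * (enorm xi `^ al - enorm eta `^ al) * psi by rewrite ler_wpM2r.
have -> : dotv X (dpsi *: G) + (a * hu + mu * b * enorm xi `^ al) * psi -
  (dotv Y (dpsi *: G) + (a * hv + mu * b * enorm eta `^ al) * psi) =
  (dotv X (dpsi *: G) - dotv Y (dpsi *: G)) + a * (hu - hv) * psi +
  mu * b * (enorm xi `^ al - enorm eta `^ al) * psi by ring.
rewrite E1; apply: le_trans (lerD (lerD (lerD h1 h2) h4) h5).
by rewrite le_eqVlt; apply/orP; left; apply/eqP; ring.
Qed.

(** The minimum of finitely many positive bounds, one for each ball of a smooth cover of the closure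
    of [V]. *)
Lemma ae_lower_bound U V (a : 'rV[R]_N -> R) : open U -> compactly_contained V U ->
  (forall O, smooth_open O -> compactly_contained O U ->
    exists2 aO : R, 0 < aO & {ae mu_N, forall x, O x -> aO <= a x}) ->
  exists2 a0 : R, 0 < a0 & {ae mu_N, forall x, V x -> a0 <= a x}.
Proof.
move=> oU [cV VU] hO.
have [s [hs cov]] := compact_smooth_cover oU cV VU.
have [a0 a00 ha0] : exists2 a0 : R, 0 < a0 & {ae mu_N, forall x, (exists2 O, O \in s & O x) -> a0 <= a x}.
  elim: s hs {cov} => [|O s IH] hs.
    by exists 1 => //; apply: aeW => x [].
  have [a1 a10 h1] : exists2 a0 : R, 0 < a0 & {ae mu_N, forall x, (exists2 O, O \in s & O x) -> a0 <= a x}.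
    by apply: IH => W Ws; apply: hs; rewrite in_cons Ws orbT.
  have [Os Oc] : smooth_open O /\ compactly_contained O U by apply: hs; rewrite mem_head.
  have [a2 a20 h2] := hO O Os Oc.
  exists (Num.min a1 a2); first by rewrite lt_min a10.
  apply: filterS2 h1 h2 => x g1 g2 [W]; rewrite in_cons => /orP[/eqP ->|Ws] Wx.
    by rewrite ge_min g2// orbT.
  by rewrite ge_min g1//; exists W.
exists a0 => //; apply: filterS ha0 => x h Vx; apply: h; apply: cov.
exact: subset_closure.
Qed.

Lemma ae_grad_bound U V (F : 'rV[R]_N -> 'rV[R]_N) : open V -> compactly_contained V U ->
  (forall i, Linfty_loc U (fun x => F x ord0 i)) ->
  exists M, {ae mu_N, forall x, V x -> forall i, `|F x ord0 i| <= M}.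
Proof.
move=> oV VU hF.
have /choice[Mi hMi] : forall i, exists M, {ae mu_N, forall x, V x -> `|F x ord0 i| <= M}.
  by move=> i; have [_ /(_ V oV VU)] := hF i.
exists (\sum_(i < N) `|Mi i|).
have : {ae mu_N, forall x, forall i, V x -> `|F x ord0 i| <= Mi i} by exact: filter_forall.
apply: filterS => x h Vx i; apply: le_trans (h i Vx) _; apply: le_trans (ler_norm _) _.
by rewrite (bigD1 i)//= lerDl sumr_ge0.
Qed.

Lemma compact_bound (K : set 'rV[R]_N) f : compact K -> K !=set0 -> {within K, continuous f} ->
  exists M, forall x, K x -> `|f x| <= M.
Proof.
move=> cK K0 cf.
have cnf : {within K, continuous (fun x => `|f x|)}.
  by move=> x; exact: (@continuous_comp (subspace K) R R f Num.Def.normr x (cf x) (@norm_continuous _ _ _)).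
have [c _ hc] := compact_EVT_max K0 cK cnf.
by exists `|f c| => x Kx; apply: hc; rewrite inE.
Qed.

Lemma expinv_shift_smooth (k : R) : smooth (fun t : R => expinv 0 (t - k)).
Proof.
rewrite (_ : (fun t => _) = (fun t => expinv 0 (- k + 1 * t))).
  by apply: smooth_affine; exact: smooth_expinv.
by apply/funext => t; rewrite mul1r addrC.
Qed.

Lemma derive1_expinv_shift (k t : R) : derive1 (fun t : R => expinv 0 (t - k)) t = expinv 2 (t - k).
Proof.
have h : is_derive (- k + 1 * t) 1 (expinv 0) (expinv 2 (- k + 1 * t)).
  have := is_derive_expinv 0 (- k + 1 * t); by rewrite oppr0 mul0r add0r.
have := is_derive_affine h; rewrite !mul1r (addrC (- k)) => -[_ E].
rewrite derive1E -E; congr ('D_1 _ t); apply/funext => s.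
by rewrite mul1r addrC.
Qed.

(** The inequality Psi' >= C Psi, from Psi(t) = t^2 Psi'(t) and t <= tau. For t <= 0 both sides
    vanish. *)
Lemma expinv_ratio (C tau t : R) : 0 <= C -> C * tau ^+ 2 <= 1 -> t <= tau ->
  C * expinv 0 t <= expinv 2 t.
Proof.
move=> C0 Ctau ttau; have [t0|t0] := leP t 0; first by rewrite !expinv_le0// mulr0.
rewrite (expinvS2 0) mulrA ler_piMl ?expinv_ge0//.
apply: le_trans Ctau; rewrite ler_wpM2l// ler_pXn2r ?nnegrE ?(ltW t0)//.
by apply: le_trans ttau; exact: ltW.
Qed.

Lemma Rintegral_sum (D : set 'rV[R]_N) (I : Type) (s : seq I) (F : I -> 'rV[R]_N -> R) :
  measurable D -> (forall i, mu_N.-integrable D (EFin \o F i)) ->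
  mu_N.-integrable D (EFin \o (fun x => \sum_(i <- s) F i x)) /\
  \int[mu_N]_(x in D) (\sum_(i <- s) F i x) = \sum_(i <- s) \int[mu_N]_(x in D) F i x.
Proof.
move=> mD iF; elim: s => [|i s [IH1 IH2]].
  have E : (fun x : 'rV[R]_N => \sum_(i <- [::]) F i x) = cst 0.
    by apply/funext => x; rewrite big_nil.
  rewrite E Rintegral_cst// mul0r big_nil; split => //.
  exact: (@integrable0 _ _ _ mu_N D).
have E : (fun x : 'rV[R]_N => \sum_(j <- i :: s) F j x) = (fun x => F i x + \sum_(j <- s) F j x).
  by apply/funext => x; rewrite big_cons.
rewrite E; split; first by have := integrableD mD (iF i) IH1.
by rewrite RintegralD// IH2 big_cons.
Qed.

Lemma comparison_principle (p al mu : R) (U : set 'rV[R]_N) (h : R -> R)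
  (a b u v : 'rV[R]_N -> R) (Du Dv : 'rV[R]_N -> 'rV[R]_N) :
  1 < p -> p - 1 <= al -> open U -> bounded_set U ->
  {homo h : s t / s < t} -> continuous h -> Linfty_loc U a -> Linfty_loc U b ->
  (forall O : set 'rV[R]_N, smooth_open O -> compactly_contained O U ->
    exists2 aO : R, 0 < aO & {ae mu_N, forall x, O x -> aO <= a x}) ->
  W1infty_loc U u Du -> {within U, continuous u} ->
  W1infty_loc U v Dv -> {within U, continuous v} ->
  (forall phi : 'rV[R]_N -> R, test_function U phi -> (forall x, 0 <= phi x) ->
    weak_form U p al mu h a b u Du phi <= 0) ->
  (forall phi : 'rV[R]_N -> R, test_function U phi -> (forall x, 0 <= phi x) ->
    0 <= weak_form U p al mu h a b v Dv phi) ->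
  nonpos_bdry U (fun x => u x - v x) ->
  forall x, U x -> u x <= v x.
Proof.
move=> p1 alp oU bU hh ch [ma ha] [mb hb] apos hu cu hv cv usub vsup bz x0 Ux0.
have [p0 al0] : 0 < p - 1 /\ 0 < al by split; lra.
rewrite leNgt; apply/negP => vu.
(* Half of the value at [x0]: the level is positive, and [x0] still belongs to [V]. *)
pose z x := u x - v x; pose k := z x0 / 2.
have k0 : 0 < k by rewrite divr_gt0// subr_gt0.
have cz : {within U, continuous z}.
  by move=> x; exact: (@continuousB _ _ (subspace U) u v x (cu x) (cv x)).
pose g := trunc U z k; pose V := [set x | 0 < g x].
have cg : continuous g by exact: trunc_continuous.
have VU : compactly_contained V U by exact: trunc_compactly_contained.
have oV : open V.
  rewrite (_ : V = g @^-1` [set t | 0 < t])//.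
  by apply: open_comp; [move=> x _; exact: cg|exact: open_gt].
have Vx0 : V x0.
  by rewrite /V /= /g truncE// ?subr_gt0 /k /z; lra.
have VsU : V `<=` U by move=> y Vy; apply: (VU.2); exact: subset_closure.
have gV x : V x -> g x = u x - v x - k by move=> /trunc_gt0[_ []].
have g0 x : ~ V x -> g x = 0.
  move=> nV; apply/le_anti; rewrite trunc_ge0 andbT leNgt; exact/negP.
have [L VL] := compactly_contained_norm VU.
have gc : continuous_csupp g.
  by split => //; exists L => x Lx; apply: g0 => /VL; rewrite leNgt Lx.
have bg := continuous_csupp_bounded_csupp gc.
pose K := closure V.
have cK : compact K by case: VU.
have KU : K `<=` U by case: VU.
have VK : V `<=` K by exact: subset_closure.
have K0 : K !=set0 by exists x0; exact: VK.
have [c Kc hc] := compact_EVT_max K0 cK (continuous_subspaceT cg).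
pose m := g c.
have gm x : g x <= m.
  have [Vx|nVx] := pselect (V x); first by apply: hc; rewrite inE; exact: VK.
  by rewrite g0//; exact: trunc_ge0.
have m0 : 0 < m by apply: lt_le_trans (gm x0).
have cuK : {within K, continuous u} by exact: continuous_subspaceW cu.
have cvK : {within K, continuous v} by exact: continuous_subspaceW cv.
have [Mu uM] := compact_bound cK K0 cuK.
have [Mv vM] := compact_bound cK K0 cvK.
have chu : {within K, continuous (h \o u)}.
  by move=> x; exact: (@continuous_comp (subspace K) R R u h x (cuK x) (ch _)).
have chv : {within K, continuous (h \o v)}.
  by move=> x; exact: (@continuous_comp (subspace K) R R v h x (cvK x) (ch _)).
have [Mhu huM] := compact_bound cK K0 chu.
have [Mhv hvM] := compact_bound cK K0 chv.
(* On [V] one has [u > v + k], so [h(u) - h(v)] is at least [h(v + k) - h(v)]. The latter is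
   continuous and positive on the compact set [K], so its minimum [d0] is positive although [h] has
   no modulus of monotonicity. *)
have chd : {within K, continuous (fun x => h (v x + k) - h (v x))}.
  have c1 : {within K, continuous (fun x => v x + k)}.
    by move=> x; exact: (@continuousD _ _ (subspace K) v (cst k) x (cvK x) (@cst_continuous _ _ _ x)).
  have c2 : {within K, continuous (h \o (fun x => v x + k))}.
    by move=> x; exact: (@continuous_comp (subspace K) R R _ h x (c1 x) (ch _)).
  by move=> x; exact: (@continuousB _ _ (subspace K) _ _ x (c2 x) (chv x)).
have [y0 _ hy0] := compact_EVT_min K0 cK chd.
pose d0 := h (v y0 + k) - h (v y0).
have d00 : 0 < d0 by rewrite subr_gt0 hh// ltrDl.
have hd0 x : V x -> d0 <= h (u x) - h (v x).
  move=> Vx; have : d0 <= h (v x + k) - h (v x) by apply: hy0; rewrite inE; exact: VK.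
  move=> /le_trans; apply; rewrite lerD2r; apply: ltW; apply: hh.
  by have /trunc_gt0[_ [+ _]] := Vx; rewrite /z; lra.
have [a0 a00 ha0] := ae_lower_bound oU VU apos.
have [Ma haM] := ha V oV VU.
have [Mb hbM] := hb V oV VU.
have [_ hDu _] := hu; have [_ hDv _] := hv.
have [M1 hM1] := ae_grad_bound oV VU hDu.
have [M2 hM2] := ae_grad_bound oV VU hDv.
pose M := Num.sqrt (N%:R * (`|M1| + `|M2|) ^+ 2).
(* One null set serves for all almost-everywhere bounds on the coefficients and the gradients. *)
have [Z [mZ Z0 hZ]] : {ae mu_N, forall x, V x ->
    [/\ a0 <= a x, `|a x| <= Ma, `|b x| <= Mb, (forall i, `|Du x ord0 i| <= `|M1| + `|M2|) &
     (forall i, `|Dv x ord0 i| <= `|M1| + `|M2|)]}.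
  apply: filterS2 (filterI (filterI ha0 haM) hbM) (filterI hM1 hM2) => x [[h1 h2] h3] [h4 h5] Vx.
  split; [exact: h1|exact: h2|exact: h3|move=> i|move=> i].
    by apply: le_trans (h4 Vx i) _; apply: le_trans (ler_norm _) _; rewrite lerDl.
  by apply: le_trans (h5 Vx i) _; apply: le_trans (ler_norm _) _; rewrite lerDr.
pose E := V `\` Z.
have EP x : E x -> [/\ a0 <= a x, `|a x| <= Ma, `|b x| <= Mb,
    (forall i, `|Du x ord0 i| <= `|M1| + `|M2|) & (forall i, `|Dv x ord0 i| <= `|M1| + `|M2|)].
  move=> [Vx nZx]; apply: contrapT => nP; apply: nZx; apply: hZ => /= H; apply: nP; exact: H.
have EDu x : E x -> enorm (Du x) <= M by move=> /EP[_ _ _ H _]; exact: enorm_le.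
have EDv x : E x -> enorm (Dv x) <= M by move=> /EP[_ _ _ _ H]; exact: enorm_le.
have mU := measurable_open_rV oU; have mV := measurable_open_rV oV.
have mE : measurable E by exact: measurableD.
have EU : E `<=` U by move=> y [/VsU].
have EL y : E y -> `|y| <= L by move=> [/VL].
have M0 : 0 <= M by exact: sqrtr_ge0.
(* The zero-order term is at least [a0 * d0 = 2 d] times phi; one half pays for the additive [d] of
   [power_gap], the other half survives. *)
pose d := a0 * d0 / 2.
have d_gt0 : 0 < d by rewrite divr_gt0// mulr_gt0.
have Kb0 : 0 <= `|mu| * `|Mb| by rewrite mulr_ge0.
have [C C0 gap] := power_gap p0 al0 M0 Kb0 d_gt0.
(* The bound [m / 2] keeps [kap] positive; the bounds 1 and 1/C give [C * tau ^+ 2 <= 1], as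
   required by [expinv_ratio]. *)
pose tau := Num.min (m / 2) (Num.min 1 C^-1).
have tau0 : 0 < tau by rewrite /tau !lt_min divr_gt0//= ltr01/= invr_gt0.
have taum : tau <= m / 2 by rewrite /tau ge_min lexx.
have tau1 : tau <= 1 by rewrite /tau !ge_min lexx orbT.
have tauC : tau <= C^-1 by rewrite /tau !ge_min lexx !orbT.
have Ctau : C * tau ^+ 2 <= 1.
  rewrite expr2 mulrA; apply: mulr_ile1 => //; rewrite ?mulr_ge0 ?(ltW tau0) ?(ltW C0)//.
  by rewrite mulrC -ler_pdivlMr// mul1r.
pose kap := m - tau.
have kap0 : 0 < kap by rewrite /kap; clear - taum m0; lra.
(* [om] bounds both the oscillation of [g] at scale [d1] and the distance from [w] to [g]. With
   [om <= kap / 2], the condition [w x > kap] forces [g > 0] on the ball of radius [r] around [x].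
   With [om <= tau / 3], on [B] one gets [w > m - 2 om >= kap + tau / 3]. *)
pose om := Num.min (kap / 2) (tau / 3).
have om0 : 0 < om by rewrite /om lt_min !divr_gt0.
have omk : om <= kap / 2 by rewrite /om ge_min lexx.
have omt : om <= tau / 3 by rewrite /om ge_min lexx orbT.
have [_ [Lg g0L]] := gc.
have [d1 d10 gun] := compact_support_unif cg g0L om0.
(* A ball around the maximum point, chosen before [r]: the lower bound [c0 * beta] of the integral
   of [phi] does not depend on [r]. *)
pose B := ball c d1.
have mB : measurable B by apply: measurable_open_rV; exact: ball_open.
have gB x : B x -> m - om < g x.
  by rewrite /B mx_norm_ball /ball_ /= => /gun; rewrite -/m ltr_norml ltrBlDr ltrBlDl => /andP[].
have BV : B `<=` V.
  move=> x /gB; apply: lt_trans; rewrite subr_gt0; apply: le_lt_trans omt _; clear - taum tau0 m0; lra.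
have Boo : (mu_N B < +oo)%E.
  apply: le_lt_trans (lebesgueN_ball_lty N L).
  by apply: le_measure; rewrite ?inE//; [exact: measurable_norm_le|move=> x /BV/VL].
pose beta := fine (mu_N B).
have beta0 : 0 < beta by rewrite fine_gt0// Boo andbT; exact: lebesgueN_ball_gt0.
pose c0 := expinv 0 (tau / 3).
have c00 : 0 < c0 by rewrite expinv_gt0// divr_gt0.
pose T := M `^ (p - 1).
have T0 : 0 <= T by exact: powR_ge0.
pose f i := (fun y => Du y ord0 i - Dv y ord0 i) \_ E.
have bf i : bounded_csupp (f i).
  have [mDui _] := hDu i; have [mDvi _] := hDv i.
  apply: (@bounded_csupp_patch _ _ U E _ ((`|M1| + `|M2|) + (`|M1| + `|M2|)) L) => //.
    exact: measurable_funB.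
  move=> x /EP[_ _ _ H1 H2]; apply: le_trans (ler_normB _ _) _; exact: lerD.
(* The total error is at most [2 T * 2 * N * eps]: [2 T] bounds each coordinate of the flux
   difference, the second 2 bounds Psi', and there are [N] coordinates. The 1 in the denominator
   makes the final inequality strict. *)
pose eps := d * (c0 * beta) / (2 * T * 2 * N%:R + 1).
have den0 : 0 < 2 * T * 2 * N%:R + 1 by rewrite ltr_wpDl// !mulr_ge0.
have eps0 : 0 < eps by rewrite /eps divr_gt0// !mulr_gt0.
(* The finitely many coordinates share one radius; the bound [r < d1] gives [|w - g| <= om]. *)
have [r [r0 rd1 hr]] : exists r : R, [/\ 0 < r, r < d1 &
    forall i, \int[mu_N]_x `|conv (f i) (mol r) x - f i x| <= eps].
  have H : \forall r \near (0:R)^'+, forall i, \int[mu_N]_x `|conv (f i) (mol r) x - f i x| <= eps.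
    apply: filter_forall => i; have [ri ri0 hi] := conv_mol_L1 (bf i) eps0.
    near=> r; apply: hi; near: r; [exact: nbhs_right_gt|exact: nbhs_right_lt].
  near (0:R)^'+ => r; exists r; split; near: r;
    [exact: nbhs_right_gt|exact: nbhs_right_lt|exact: H].
have mr := @continuous_csupp_mol R N r r0.
pose w := conv g (mol r).
have wC : Cinfty w by exact: Cinfty_conv_mol.
have wg x : `|w x - g x| <= om.
  by apply: conv_mol_dist => // y xy; apply/ltW/gun; exact: lt_trans rd1.
(* Averages of [g] do not exceed its maximum, so [w - kap <= tau], the range covered by
   [expinv_ratio]. *)
have wm x : w x <= m by apply: conv_mol_le.
pose Psi (t : R) := expinv 0 (t - kap).
have Psi_smooth : smooth Psi by exact: expinv_shift_smooth.
pose phi := Psi \o w.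
have phiC : Cinfty phi by move=> n; apply: Cn_comp => //; exact: wC.
have phi_ge0 x : 0 <= phi x by exact: expinv_ge0.
have wV x : kap < w x -> forall y, `|x - y| <= r -> V y.
  move=> kw y xy; have /gun := le_lt_trans xy rd1; rewrite ltr_norml => /andP[_ h1].
  have := wg x; rewrite ler_norml => /andP[_ h2]; rewrite /V /=.
  clear - h1 h2 kw omk; lra.
have nVw x : ~ V x -> w x <= kap.
  by move=> nV; rewrite leNgt; apply/negP => /wV/(_ x) hx; apply/nV/hx; rewrite subrr normr0 ltW.
have phi0 x : ~ V x -> phi x = 0.
  by move=> /nVw hx; rewrite /phi /= /Psi expinv_le0// subr_le0.
(* Where [w <= kap] both sides vanish with Psi'. Elsewhere the ball of radius [r] around [x] lies in
   [V], and the gradient of [w] is the mollified difference of the weak gradients. *)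
have dphiE i x : partial i phi x = expinv 2 (w x - kap) * conv (f i) (mol r) x.
  rewrite /phi (partial_comp i x Psi_smooth (wC 1)) derive1_expinv_shift.
  have [hx|hx] := leP (w x) kap; first by rewrite expinv_le0 ?subr_le0// !mul0r.
  congr (_ * _); apply: (partial_conv_weak (Mu := Mu) (Mv := Mv) (M := `|M1| + `|M2|) oU oV VU mZ Z0 hu hv) => //.
  - by move=> y Vy; apply: uM; exact: VK.
  - by move=> y Vy; apply: vM; exact: VK.
  - by move=> y /EP[].
  - by move=> y /EP[].
  - exact: gV.
  - exact: wV.
have dphi0 x i : ~ V x -> partial i phi x = 0.
  by move=> /nVw hx; rewrite dphiE expinv_le0 ?mul0r// subr_le0.
have test : test_function U phi.
  split => //; apply: compactly_contained_sub VU => x /= hx; apply: contrapT => /phi0 h0.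
  by rewrite h0 eqxx in hx.
have huM' x : E x -> `|h (u x)| <= Mhu by move=> [Vx _]; apply: huM; exact: VK.
have hvM' x : E x -> `|h (v x)| <= Mhv by move=> [Vx _]; apply: hvM; exact: VK.
have aM x : E x -> `|a x| <= Ma by move=> /EP[].
have bM x : E x -> `|b x| <= Mb by move=> /EP[].
have [Iu [iu Eu IuE]] : exists I : 'rV[R]_N -> R, [/\ mu_N.-integrable E (EFin \o I),
    weak_form U p al mu h a b u Du phi = \int[mu_N]_(x in E) I x &
    forall x, I x = dotv (pflux p (Du x)) (grad phi x) +
      (a x * h (u x) + mu * b x * enorm (Du x) `^ al) * phi x].
  have [i1 i2] := weak_form_restrict mu oU oV VU mZ Z0 p1 (ltW al0) ch ma mb hu aM bM huM' EDu (phiC 1) phi0 dphi0.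
  by eexists; split; [exact: i1|exact: i2|].
have [Iv [iv Ev IvE]] : exists I : 'rV[R]_N -> R, [/\ mu_N.-integrable E (EFin \o I),
    weak_form U p al mu h a b v Dv phi = \int[mu_N]_(x in E) I x &
    forall x, I x = dotv (pflux p (Dv x)) (grad phi x) +
      (a x * h (v x) + mu * b x * enorm (Dv x) `^ al) * phi x].
  have [i1 i2] := weak_form_restrict mu oU oV VU mZ Z0 p1 (ltW al0) ch ma mb hv aM bM hvM' EDv (phiC 1) phi0 dphi0.
  by eexists; split; [exact: i1|exact: i2|].
have := usub phi test phi_ge0; have := vsup phi test phi_ge0.
rewrite Eu Ev.
move=> Iv0 Iu0.
have D0 : \int[mu_N]_(x in E) (Iu x - Iv x) <= 0 by rewrite RintegralB// subr_le0; exact: le_trans Iv0.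
pose S x := \sum_(i < N) `|conv (f i) (mol r) x - f i x|.
have bS i : bounded_csupp (fun x => `|conv (f i) (mol r) x - f i x|).
  by apply: bounded_csupp_norm; apply: bounded_csuppB => //; exact/continuous_csupp_bounded_csupp/conv_continuous_csupp.
have iS i : mu_N.-integrable E (EFin \o (fun x => `|conv (f i) (mol r) x - f i x|)).
  by apply: (integrableS measurableT) => //; exact: bounded_csupp_integrable.
have [iSS ES] := Rintegral_sum (index_enum 'I_N) mE iS.
have phic : continuous_csupp phi.
  split; first exact: Cn_continuous (phiC 0).
  by exists L => x Lx; apply: phi0 => /VL; rewrite leNgt Lx.
have iphi : mu_N.-integrable E (EFin \o phi).
  by apply: (integrableS measurableT) => //; exact/bounded_csupp_integrable/continuous_csupp_bounded_csupp.
have SE : \int[mu_N]_(x in E) S x <= N%:R * eps.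
  rewrite ES -[X in X%:R * _](card_ord N) mulr_natl -sumr_const; apply: ler_sum => i _.
  apply: le_trans (hr i); rewrite Rintegral_mkcond; apply: le_Rintegral => //.
  - by rewrite -restrict_EFin; apply/(integrable_mkcond _ mE).
  - exact: bounded_csupp_integrable.
  - by move=> x _; rewrite patchE; case: ifP => _; [exact: lexx|exact: normr_ge0].
(* Dropping [Z] leaves the integral unchanged, so it can be taken over [V] and bounded below by [c0]
   on [B]. *)
have phiB : c0 * beta <= \int[mu_N]_(x in E) phi x.
  have mphi : measurable_fun V phi.
    by apply: measurable_funTS; apply: measurable_fun_continuous_rV; case: phic.
  rewrite -(@Rintegral_ae_restrict _ _ V V Z phi)//.
  have VB : V `&` B = B by rewrite setIidr.
  rewrite -Rintegral_cst// -VB Rintegral_mkcondr; apply: le_Rintegral => //.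
  - apply: (integrableS measurableT) => //; apply: bounded_csupp_integrable.
    apply: (@bounded_csupp_patch _ _ setT B (fun=> c0) c0 L) => //.
      by move=> x _; rewrite ger0_norm// ltW.
    by move=> x /BV/VL.
  - by apply: (integrableS measurableT) => //; exact/bounded_csupp_integrable/continuous_csupp_bounded_csupp.
  - move=> x Vx; rewrite patchE; case: ifPn => //; rewrite inE => Bx.
    apply: expinv0_homo.
    have := gB x Bx; have := wg x; rewrite ler_norml => /andP[h1 _] h2.
    rewrite /kap; clear - h1 h2 omt; lra.
have low x : E x -> d * phi x - 2 * T * 2 * S x <= Iu x - Iv x.
  move=> Ex; have [h1 h2 h3 _ _] := EP x Ex; have [Vx _] := Ex.
  have hS : S x = \sum_(i < N) `|(\row_j conv (f j) (mol r) x) ord0 i - (Du x ord0 i - Dv x ord0 i)|.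
    by apply: eq_bigr => i _; rewrite mxE /f patchE mem_set.
  have hG : grad phi x = expinv 2 (w x - kap) *: \row_j conv (f j) (mol r) x.
    by apply/rowP => i; rewrite !mxE dphiE.
  rewrite hS IuE IvE hG.
  apply: (@pointwise_lower p al mu C (`|mu| * `|Mb|) T 2 d (a x) (b x) _ _ _ _ _ _ _ p1).
  - exact: phi_ge0.
  - exact: ltW.
  - apply: expinv_ratio (ltW C0) Ctau _; have := wm x; rewrite /kap; clear; lra.
  (* The bound 2 on Psi' is the factorial 2! of [expinv_le]. *)
  - exact: expinv_le.
  - rewrite /d mulrC divfK//; apply: ler_pM => //; [exact: ltW|exact: ltW|exact: hd0].
  - by rewrite normrM ler_wpM2l// (le_trans h3)// ler_norm.
  - by apply: gap; rewrite enorm_ge0/= ?EDu ?EDv.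
  - by apply: ge0_ler_powR; rewrite ?nnegrE ?enorm_ge0 ?EDu ?(ltW p0).
  - by apply: ge0_ler_powR; rewrite ?nnegrE ?enorm_ge0 ?EDv ?(ltW p0).
have i1 : mu_N.-integrable E (EFin \o (fun x => d * phi x)).
  by have := integrableZl mE d iphi.
have i2 : mu_N.-integrable E (EFin \o (fun x => 2 * T * 2 * S x)).
  by have := integrableZl mE (2 * T * 2) iSS.
have : \int[mu_N]_(x in E) (d * phi x - 2 * T * 2 * S x) <= 0.
  apply: le_trans D0; apply: le_Rintegral => //.
    by have := integrableB mE i1 i2.
  by have := integrableB mE iu iv.
rewrite RintegralB// RintegralZl// RintegralZl//.
have q1 : d * (c0 * beta) <= d * \int[mu_N]_(x in E) phi x by rewrite ler_wpM2l// ltW.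
have q2 : 2 * T * 2 * \int[mu_N]_(x in E) S x <= 2 * T * 2 * (N%:R * eps).
  by rewrite ler_wpM2l// !mulr_ge0.
(* By the choice of [eps], the mollification error is strictly below the surviving zero-order
   contribution, which contradicts the sign of the difference of the weak forms. *)
have q3 : 2 * T * 2 * (N%:R * eps) < d * (c0 * beta).
  rewrite mulrA /eps mulrA ltr_pdivrMr// mulrC ltr_pM2l ?ltrDl//.
  by rewrite !mulr_gt0.
apply/negP; rewrite -ltNge; clear - q1 q2 q3; lra.
Unshelve. all: end_near. Qed.

End comparison.

Unset Implicit Arguments.

Theorem theorem2p1 (R : realType) (N : nat) (hN : (1 <= N)%N)
  (p alpha mu : R) (hp : 1 < p) (halpha : p - 1 <= alpha) (hmu : 0 <= mu)
  (Omega : set 'rV[R]_N)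
  (Omega_neq0 : Omega !=set0) (Omega_connected : connected Omega)
  (Omega_bounded : bounded_set Omega) (Omega_smooth : smooth_open Omega)
  (h : R -> R) (h_incr : {homo h : s t / s < t}) (h_cont : continuous h)
  (a b : 'rV[R]_N -> R) (ha : Linfty_loc Omega a) (hb : Linfty_loc Omega b)
  (a_pos : forall O : set 'rV[R]_N,
    smooth_open O -> compactly_contained O Omega ->
    exists2 aO : R, 0 < aO & {ae lebesgueN N, forall x, O x -> aO <= a x})
  (u v : 'rV[R]_N -> R) (Du Dv : 'rV[R]_N -> 'rV[R]_N)
  (hu : W1infty_loc Omega u Du) (u_cont : {within Omega, continuous u})
  (hv : W1infty_loc Omega v Dv) (v_cont : {within Omega, continuous v})
  (u_sub : forall phi : 'rV[R]_N -> R,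
    test_function Omega phi -> (forall x, 0 <= phi x) ->
    weak_form Omega p alpha mu h a b u Du phi <= 0)
  (v_super : forall phi : 'rV[R]_N -> R,
    test_function Omega phi -> (forall x, 0 <= phi x) ->
    0 <= weak_form Omega p alpha mu h a b v Dv phi)
  (bdry_lim : forall y, bdry Omega y ->
    exists2 l : \bar R, (l <= 0)%E &
      (u x - v x)%:E @[x --> within Omega (nbhs y)] --> l) :
  forall x, Omega x -> u x <= v x.
Proof.
exact: (comparison_principle hp halpha Omega_smooth.1 Omega_bounded h_incr h_cont
  ha hb a_pos hu u_cont hv v_cont u_sub v_super bdry_lim).
Qed.
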